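(* Let $i\in I$. (1) $U_i$ is a right $U_q(\mathfrak p_i)$-module by $$u\cdot f_i=\mathrm{ad}_{e_i}(u),\quad u\cdot e_i=\mathrm{ad}_{f_i}(u),\quad u\cdot f_j=uu_j\ (j\ne i),\quad u\cdot q^h=q^{-s_ih}uq^{s_ih}\ (h\in\mathsf P^\vee),$$ where $u_j=T_i(f_j)$. (2) ${}_iU$ is a left $U_q(\mathfrak p_i)$-module by $$f_i\cdot u=\mathrm{ad}^*_{e_i}(u),\quad e_i\cdot u=\mathrm{ad}^*_{f_i}(u),\quad f_j\cdot u=u'_ju\ (j\ne i),\quad q^h\cdot u=q^{s_ih}uq^{-s_ih}\ (h\in\mathsf P^\vee),$$ where $u'_j=T_i^{-1}(f_j)$. (3) $T_i\colon{}_iU\to U_i$ is both left $U_q(\mathfrak p_i)$-linear and right $U_q(\mathfrak p_i)$-linear, where $U_i$ carries the right structure of (1) and the left structure $f_i\cdot u=\mathrm{ad}_{f_i}(u)$, $e_i\cdot u=\mathrm{ad}_{e_i}(u)$, $f_j\cdot u=f_ju$ ($j\neq i$), $q^h\cdot u=q^huq^{-h}$, and ${}_iU$ carries the left structure of (2) and the right structure $u\cdot f_i=\mathrm{ad}^*_{f_i}(u)$, $u\cdot e_i=\mathrm{ad}^*_{e_i}(u)$, $u\cdot f_j=uf_j$ ($j\ne i$), $u\cdot q^h=q^{-h}uq^h$.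
   Context: $\mathsf A=(a_{i,j})_{i,j\in I}$ is a symmetrizable generalized Cartan matrix; $\mathsf P$ is a free abelian group, $\{\alpha_i\}\subset\mathsf P$ linearly independent, $\{h_i\}\subset\mathsf P^\vee=\mathrm{Hom}_{\mathbb Z}(\mathsf P,\mathbb Z)$, $(\cdot,\cdot)$ a symmetric $\mathbb Q$-valued bilinear form on $\mathsf P$, with $\langle h_i,\alpha_j\rangle=a_{i,j}$, $(\alpha_i,\alpha_i)\in2\mathbb Z_{>0}$, $\langle h_i,\lambda\rangle=2(\alpha_i,\lambda)/(\alpha_i,\alpha_i)$, and there exist $\Lambda_i\in\mathsf P$ with $\langle h_j,\Lambda_i\rangle=\delta_{i,j}$. $q_i=q^{(\alpha_i,\alpha_i)/2}$, $s_ih=h-\langle h,\alpha_i\rangle h_i$, $[n]_i=(q_i^n-q_i^{-n})/(q_i-q_i^{-1})$, $[n]_i!=[n]_i\cdots[1]_i$, $z_i^{(s)}=z_i^s/[s]_i!$. $U_q(\mathfrak g)$ is the $\mathbb Q(q)$-algebra generated by $e_i,f_i$ ($i\in I$), $q^h$ ($h\in\mathsf P^\vee$) with $q^0=1$, $q^hq^k=q^{h+k}$, $q^he_iq^{-h}=q^{\langle h,\alpha_i\rangle}e_i$, $q^hf_iq^{-h}=q^{-\langle h,\alpha_i\rangle}f_i$, $[e_i,f_j]=\delta_{i,j}(t_i-t_i^{-1})/(q_i-q_i^{-1})$, $t_i=q^{\frac{(\alpha_i,\alpha_i)}2h_i}$, and $\sum_{s=0}^{1-a_{i,j}}(-1)^sz_i^{(s)}z_jz_i^{(1-a_{i,j}-s)}=0$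 ($i\ne j$, $z=e,f$). $U_q^-(\mathfrak g)$ is the subalgebra generated by the $f_j$. $U_q(\mathfrak p_i)$ is the subalgebra of $U_q(\mathfrak g)$ generated by $e_i$, $f_j$ ($j\in I$), $q^h$ (equivalently, the algebra on these generators with the relations $q^0=1$, $q^hq^k=q^{h+k}$, $q^he_iq^{-h}=q^{\langle h,\alpha_i\rangle}e_i$, $q^hf_jq^{-h}=q^{-\langle h,\alpha_j\rangle}f_j$ ($j\in I$), $[e_i,f_j]=\delta_{i,j}(t_i-t_i^{-1})/(q_i-q_i^{-1})$ ($j\in I$), and $\sum_{s=0}^{1-a_{j,k}}(-1)^sf_j^{(s)}f_kf_j^{(1-a_{j,k}-s)}=0$ ($j,k\in I$, $j\ne k$)). $T_i$ is the automorphism of $U_q(\mathfrak g)$ with $T_i(q^h)=q^{s_ih}$, $T_i(e_i)=-t_i^{-1}f_i$, $T_i(f_i)=-e_it_i$, $T_i(e_j)=\sum_{r+s=-a_{i,j}}(-1)^rq_i^{-r}e_i^{(r)}e_je_i^{(s)}$, $T_i(f_j)=\sum_{r+s=-a_{i,j}}(-1)^rq_i^rf_i^{(s)}f_jf_i^{(r)}$ ($j\ne i$). $U_i=U_q^-(\mathfrak g)\cap T_iU_q^-(\mathfrak g)$, ${}_iU=U_q^-(\mathfrak g)\cap T_i^{-1}U_q^-(\mathfrak g)$, so $T_i$ restricts to an isomorphism ${}_iU\to U_i$. $\mathrm{ad}_{f_i}(u)=f_iu-t_iut_i^{-1}f_i$, $\mathrm{ad}_{e_i}(u)=e_iut_i-ue_it_i$,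 $\mathrm{ad}^*_{f_i}(u)=uf_i-f_it_iut_i^{-1}$, $\mathrm{ad}^*_{e_i}(u)=t_i^{-1}ue_i-t_i^{-1}e_iu$ (endomorphisms of $U_q(\mathfrak g)$). *)

(* Defs.v *)
From HB Require Import structures.
From mathcomp Require Import all_boot all_order all_algebra fraction.
From mathcomp Require Import boolp.
From mathcomp Require Import monalg.

Set Implicit Arguments.
Unset Strict Implicit.
Unset Printing Implicit Defensive.

Import GRing.Theory.
Local Open Scope ring_scope.
Local Open Scope quotient_scope.

Definition free_alg (K : fieldType) (G : choiceType) := {malg K[{fmonom G}]}.

HB.instance Definition _ (K : fieldType) (G : choiceType) :=
  Choice.copy (free_alg K G) {malg K[{fmonom G}]}.

(* The operations of the concrete algebras are locked to keep unification from
   unfolding them; they are those of {malg K[{fmonom G}]}. *)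
HB.lock Definition free_zero (K : fieldType) (G : choiceType) : free_alg K G :=
  (0 : {malg K[{fmonom G}]}).
HB.lock Definition free_one (K : fieldType) (G : choiceType) : free_alg K G :=
  (1 : {malg K[{fmonom G}]}).
HB.lock Definition free_opp (K : fieldType) (G : choiceType)
    (x : free_alg K G) : free_alg K G := - (x : {malg K[{fmonom G}]}).
HB.lock Definition free_add (K : fieldType) (G : choiceType)
    (x y : free_alg K G) : free_alg K G := (x : {malg K[{fmonom G}]}) + y.
HB.lock Definition free_mul (K : fieldType) (G : choiceType)
    (x y : free_alg K G) : free_alg K G := (x : {malg K[{fmonom G}]}) * y.
HB.lock Definition free_scale (K : fieldType) (G : choiceType)
    (k : K) (x : free_alg K G) : free_alg K G :=
  k *: (x : {malg K[{fmonom G}]}).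
HB.lock Definition free_gen (K : fieldType) (G : choiceType)
    (g : G) : free_alg K G := (<< fmu g >> : {malg K[{fmonom G}]}).
Arguments free_zero {K G}.
Arguments free_one {K G}.
Arguments free_opp {K G}.
Arguments free_add {K G}.
Arguments free_mul {K G}.
Arguments free_scale {K G}.
Arguments free_gen K {G}.

Section FreeAlgebra.
Variables (K : fieldType) (G : choiceType).

Local Notation malg_alg := {malg K[{fmonom G}]}.
Local Notation free_alg := (free_alg K G).
Local Notation free_zero := (@free_zero K G).
Local Notation free_one := (@free_one K G).
Local Notation free_opp := (@free_opp K G).
Local Notation free_add := (@free_add K G).
Local Notation free_mul := (@free_mul K G).
Local Notation free_scale := (@free_scale K G).

Lemma free_zeroE : free_zero = (0 : malg_alg).
Proof. by rewrite unlock. Qed.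
Lemma free_oneE : free_one = (1 : malg_alg).
Proof. by rewrite unlock. Qed.
Lemma free_oppE x : free_opp x = - (x : malg_alg).
Proof. by rewrite unlock. Qed.
Lemma free_addE x y : free_add x y = (x : malg_alg) + y.
Proof. by rewrite unlock. Qed.
Lemma free_mulE x y : free_mul x y = (x : malg_alg) * y.
Proof. by rewrite unlock. Qed.
Lemma free_scaleE k x : free_scale k x = k *: (x : malg_alg).
Proof. by rewrite unlock. Qed.
Lemma free_genE g : free_gen K g = (<< fmu g >> : malg_alg).
Proof. by rewrite unlock. Qed.

Local Notation freeE :=
  (free_zeroE, free_oneE, free_oppE, free_addE, free_mulE, free_scaleE).

Lemma free_addA : associative free_add.
Proof. by move=> x y z; rewrite !freeE addrA. Qed.
Lemma free_addC : commutative free_add.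
Proof. by move=> x y; rewrite !freeE addrC. Qed.
Lemma free_add0 : left_id free_zero free_add.
Proof. by move=> x; rewrite !freeE add0r. Qed.
Lemma free_addN : left_inverse free_zero free_opp free_add.
Proof. by move=> x; rewrite !freeE addNr. Qed.

HB.instance Definition _ :=
  GRing.isZmodule.Build free_alg free_addA free_addC free_add0 free_addN.

Lemma free_mulA : associative free_mul.
Proof. by move=> x y z; rewrite !freeE mulrA. Qed.
Lemma free_mul1 : left_id free_one free_mul.
Proof. by move=> x; rewrite !freeE mul1r. Qed.
Lemma free_mulr1 : right_id free_one free_mul.
Proof. by move=> x; rewrite !freeE mulr1. Qed.
Lemma free_mulDl : left_distributive free_mul free_add.
Proof. by move=> x y z; rewrite !freeE mulrDl. Qed.
Lemma free_mulDr : right_distributive free_mul free_add.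
Proof. by move=> x y z; rewrite !freeE mulrDr. Qed.
Lemma free_oner_neq0 : free_one != free_zero.
Proof. by rewrite !freeE oner_neq0. Qed.

HB.instance Definition _ := GRing.Zmodule_isNzRing.Build free_alg
  free_mulA free_mul1 free_mulr1 free_mulDl free_mulDr free_oner_neq0.

Lemma free_scaleA k l x : free_scale k (free_scale l x) = free_scale (k * l) x.
Proof. by rewrite !freeE scalerA. Qed.
Lemma free_scale1 : left_id 1 free_scale.
Proof. by move=> x; rewrite !freeE scale1r. Qed.
Lemma free_scaleDr : right_distributive free_scale free_add.
Proof. by move=> k x y; rewrite !freeE scalerDr. Qed.
Lemma free_scaleDl x k l :
  free_scale (k + l) x = free_add (free_scale k x) (free_scale l x).
Proof. by rewrite !freeE scalerDl. Qed.

HB.instance Definition _ := GRing.Zmodule_isLmodule.Build K free_alg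
  free_scaleA free_scale1 free_scaleDr free_scaleDl.

Lemma free_scaleAl k x y :
  free_scale k (free_mul x y) = free_mul (free_scale k x) y.
Proof. by rewrite !freeE scalerAl. Qed.

HB.instance Definition _ :=
  GRing.Lmodule_isLalgebra.Build K free_alg free_scaleAl.

Lemma free_scaleAr k x y :
  free_scale k (free_mul x y) = free_mul x (free_scale k y).
Proof.
rewrite !freeE; apply/malgP => m.
rewrite mcoeffZ.
rewrite [X in _ * X = _]mcoeffMl.
rewrite (@mcoeffMlw _ _ (msupp x) (msupp y) x _ m) ?msuppZ_le // mulr_sumr.
apply: eq_bigr => p _; rewrite mulr_sumr; apply: eq_bigr => r _.
by rewrite mcoeffZ mulrCA mulrnAr.
Qed.

HB.instance Definition _ :=
  GRing.Lalgebra_isAlgebra.Build K free_alg free_scaleAr.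

End FreeAlgebra.

(* Quotient of an algebra by the two-sided ideal generated by all lhs - rhs
   with [R lhs rhs].  An [algType] is non-trivial, so properness of the ideal
   is part of the data. *)
Section QuotientAlgebra.
Variables (K : fieldType) (A : algType K).

Inductive gen_ideal (R : A -> A -> Prop) : A -> Prop :=
| gen_ideal_rel x y : R x y -> gen_ideal R (x - y)
| gen_ideal0 : gen_ideal R 0
| gen_idealD x y : gen_ideal R x -> gen_ideal R y -> gen_ideal R (x + y)
| gen_idealM a b x : gen_ideal R x -> gen_ideal R (a * x * b).

Variables (R : A -> A -> Prop) (properR : ~ gen_ideal R 1).

Local Notation I := (gen_ideal R).

Lemma gen_idealMl a x : I x -> I (a * x).
Proof. by move=> Ix; rewrite -[_ * _]mulr1; apply: gen_idealM. Qed.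

Lemma gen_idealMr x b : I x -> I (x * b).
Proof. by move=> Ix; rewrite -[x]mul1r; apply: gen_idealM. Qed.

Lemma gen_idealN x : I x -> I (- x).
Proof. by move=> Ix; rewrite -mulN1r; apply: gen_idealMl. Qed.

Lemma gen_idealZ k x : I x -> I (k *: x).
Proof. by move=> Ix; rewrite -mulr_algl; apply: gen_idealMl. Qed.

Definition ideal_equiv (x y : A) : bool := `[< gen_ideal R (x - y) >].

Lemma ideal_equiv_is_equiv : equiv_class_of ideal_equiv.
Proof.
split=> [x | x y | y x z].
- by apply/asboolP; rewrite subrr; apply: gen_ideal0.
- by apply: asbool_equiv_eq; split=> /gen_idealN; rewrite opprB.
- move=> /asboolP Ixy /asboolP Iyz; apply/asboolP.
  by rewrite -[x](subrK y) -addrA; apply: gen_idealD.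
Qed.

Canonical ideal_equiv_equiv := EquivRelPack ideal_equiv_is_equiv.

Definition quot_alg & ~ gen_ideal R 1 := {eq_quot ideal_equiv}.

HB.instance Definition _ := Choice.on (quot_alg properR).
HB.instance Definition _ := EqQuotient.on (quot_alg properR).

End QuotientAlgebra.

HB.lock Definition quot_pi (K : fieldType) (A : algType K)
    (R : A -> A -> Prop) (properR : ~ gen_ideal R 1) (x : A) :
  quot_alg properR := \pi x.
HB.lock Definition quot_add (K : fieldType) (A : algType K)
    (R : A -> A -> Prop) (properR : ~ gen_ideal R 1)
    (u v : quot_alg properR) := quot_pi properR (repr u + repr v).
HB.lock Definition quot_opp (K : fieldType) (A : algType K)
    (R : A -> A -> Prop) (properR : ~ gen_ideal R 1)
    (u : quot_alg properR) := quot_pi properR (- repr u).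
HB.lock Definition quot_mul (K : fieldType) (A : algType K)
    (R : A -> A -> Prop) (properR : ~ gen_ideal R 1)
    (u v : quot_alg properR) := quot_pi properR (repr u * repr v).
HB.lock Definition quot_scale (K : fieldType) (A : algType K)
    (R : A -> A -> Prop) (properR : ~ gen_ideal R 1)
    (k : K) (u : quot_alg properR) := quot_pi properR (k *: repr u).
Arguments quot_pi {K A R} properR.
Arguments quot_add {K A R properR}.
Arguments quot_opp {K A R properR}.
Arguments quot_mul {K A R properR}.
Arguments quot_scale {K A R properR}.

Section QuotientAlgebraTheory.
Variables (K : fieldType) (A : algType K).
Variables (R : A -> A -> Prop) (properR : ~ gen_ideal R 1).

Local Notation Q := (quot_alg properR).
Local Notation quot_pi := (quot_pi properR).
Local Notation quot_add := (@quot_add _ _ _ properR).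
Local Notation quot_opp := (@quot_opp _ _ _ properR).
Local Notation quot_mul := (@quot_mul _ _ _ properR).
Local Notation quot_scale := (@quot_scale _ _ _ properR).

Lemma quot_piP x y : quot_pi x = quot_pi y <-> gen_ideal R (x - y).
Proof.
rewrite unlock; split=> [/eqquotP/asboolP // | Ixy].
by apply/eqquotP; apply/asboolP.
Qed.

Lemma quot_reprK (u : Q) : quot_pi (repr u) = u.
Proof. by rewrite unlock reprK. Qed.

Lemma quot_pi_repr x : gen_ideal R (repr (quot_pi x) - x).
Proof. by apply/quot_piP; rewrite quot_reprK. Qed.

Lemma quot_addE x y : quot_add (quot_pi x) (quot_pi y) = quot_pi (x + y).
Proof.
rewrite quot_add.unlock; apply/quot_piP; rewrite opprD addrACA.
by apply: gen_idealD; apply: quot_pi_repr.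
Qed.

Lemma quot_oppE x : quot_opp (quot_pi x) = quot_pi (- x).
Proof.
rewrite quot_opp.unlock; apply/quot_piP; rewrite -opprD.
exact/gen_idealN/quot_pi_repr.
Qed.

Lemma quot_mulE x y : quot_mul (quot_pi x) (quot_pi y) = quot_pi (x * y).
Proof.
rewrite quot_mul.unlock; apply/quot_piP; set x' := repr _; set y' := repr _.
have -> : x' * y' - x * y = x' * (y' - y) + (x' - x) * y.
  by rewrite mulrBr mulrBl addrA subrK.
by apply: gen_idealD; [apply: gen_idealMl | apply: gen_idealMr];
  apply: quot_pi_repr.
Qed.

Lemma quot_scaleE k x : quot_scale k (quot_pi x) = quot_pi (k *: x).
Proof.
rewrite quot_scale.unlock; apply/quot_piP; rewrite -scalerBr.
exact/gen_idealZ/quot_pi_repr.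
Qed.

Local Notation quotE := (quot_addE, quot_oppE, quot_mulE, quot_scaleE).

Lemma quot_addA : associative quot_add.
Proof.
move=> u v w; rewrite -(quot_reprK u) -(quot_reprK v) -(quot_reprK w).
by rewrite !quotE addrA.
Qed.

Lemma quot_addC : commutative quot_add.
Proof.
by move=> u v; rewrite -(quot_reprK u) -(quot_reprK v) !quotE addrC.
Qed.

Lemma quot_add0 : left_id (quot_pi 0) quot_add.
Proof. by move=> u; rewrite -(quot_reprK u) !quotE add0r. Qed.

Lemma quot_addN : left_inverse (quot_pi 0) quot_opp quot_add.
Proof. by move=> u; rewrite -(quot_reprK u) !quotE addNr. Qed.

HB.instance Definition _ :=
  GRing.isZmodule.Build Q quot_addA quot_addC quot_add0 quot_addN.

Lemma quot_mulA : associative quot_mul.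
Proof.
move=> u v w; rewrite -(quot_reprK u) -(quot_reprK v) -(quot_reprK w).
by rewrite !quotE mulrA.
Qed.

Lemma quot_mul1 : left_id (quot_pi 1) quot_mul.
Proof. by move=> u; rewrite -(quot_reprK u) !quotE mul1r. Qed.

Lemma quot_mulr1 : right_id (quot_pi 1) quot_mul.
Proof. by move=> u; rewrite -(quot_reprK u) !quotE mulr1. Qed.

Lemma quot_mulDl : left_distributive quot_mul quot_add.
Proof.
move=> u v w; rewrite -(quot_reprK u) -(quot_reprK v) -(quot_reprK w).
by rewrite !quotE mulrDl.
Qed.

Lemma quot_mulDr : right_distributive quot_mul quot_add.
Proof.
move=> u v w; rewrite -(quot_reprK u) -(quot_reprK v) -(quot_reprK w).
by rewrite !quotE mulrDr.
Qed.

Lemma quot_oner_neq0 : quot_pi 1 != 0 :> Q.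
Proof. by apply/eqP => /quot_piP; rewrite subr0. Qed.

HB.instance Definition _ := GRing.Zmodule_isNzRing.Build Q
  quot_mulA quot_mul1 quot_mulr1 quot_mulDl quot_mulDr quot_oner_neq0.

Lemma quot_scaleA k l (u : Q) :
  quot_scale k (quot_scale l u) = quot_scale (k * l) u.
Proof. by rewrite -(quot_reprK u) !quotE scalerA. Qed.

Lemma quot_scale1 : left_id 1 quot_scale.
Proof. by move=> u; rewrite -(quot_reprK u) !quotE scale1r. Qed.

Lemma quot_scaleDr : right_distributive quot_scale +%R.
Proof.
move=> k u v; rewrite -(quot_reprK u) -(quot_reprK v).
rewrite -[LHS]/(quot_scale k (quot_add _ _)) quot_addE !quot_scaleE scalerDr.
exact/esym/quot_addE.
Qed.

Lemma quot_scaleDl (u : Q) : {morph quot_scale^~ u : k l / k + l}.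
Proof.
move=> k l; rewrite -(quot_reprK u) !quot_scaleE scalerDl.
exact/esym/quot_addE.
Qed.

HB.instance Definition _ := GRing.Zmodule_isLmodule.Build K Q
  quot_scaleA quot_scale1 quot_scaleDr quot_scaleDl.

Lemma quot_scaleAl k (u v : Q) : k *: (u * v) = (k *: u) * v.
Proof.
rewrite -(quot_reprK u) -(quot_reprK v).
rewrite -[LHS]/(quot_scale _ (quot_mul _ _)) quot_mulE quot_scaleE scalerAl.
by rewrite -[RHS]/(quot_mul (quot_scale _ _) _) quot_scaleE quot_mulE.
Qed.

HB.instance Definition _ := GRing.Lmodule_isLalgebra.Build K Q quot_scaleAl.

Lemma quot_scaleAr k (u v : Q) : k *: (u * v) = u * (k *: v).
Proof.
rewrite -(quot_reprK u) -(quot_reprK v).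
rewrite -[LHS]/(quot_scale _ (quot_mul _ _)) quot_mulE quot_scaleE scalerAr.
by rewrite -[RHS]/(quot_mul _ (quot_scale _ _)) quot_scaleE quot_mulE.
Qed.

HB.instance Definition _ := GRing.Lalgebra_isAlgebra.Build K Q quot_scaleAr.

Lemma quot_pi_is_zmod_morphism : zmod_morphism quot_pi.
Proof. by move=> x y; rewrite -quot_addE -quot_oppE. Qed.

HB.instance Definition _ :=
  GRing.isZmodMorphism.Build A Q quot_pi quot_pi_is_zmod_morphism.

Lemma quot_pi_is_monoid_morphism : monoid_morphism quot_pi.
Proof. by split=> // x y; rewrite -quot_mulE. Qed.

HB.instance Definition _ :=
  GRing.isMonoidMorphism.Build A Q quot_pi quot_pi_is_monoid_morphism.

Lemma quot_pi_is_scalable : scalable quot_pi.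
Proof. by move=> k x; rewrite -quot_scaleE. Qed.

HB.instance Definition _ :=
  GRing.isScalable.Build K A Q *:%R quot_pi quot_pi_is_scalable.

End QuotientAlgebraTheory.

Section GeneratedSubalgebra.
Variables (K : fieldType) (A : algType K).

Inductive gen_subalg (S : A -> Prop) : A -> Prop :=
| gen_subalg_gen x : S x -> gen_subalg S x
| gen_subalg_const (k : K) : gen_subalg S k%:A
| gen_subalgD x y : gen_subalg S x -> gen_subalg S y -> gen_subalg S (x + y)
| gen_subalgM x y : gen_subalg S x -> gen_subalg S y -> gen_subalg S (x * y).

Variable S : A -> Prop.

Definition subalg : {pred A} := fun x => `[< gen_subalg S x >].

Lemma subalgP x : reflect (gen_subalg S x) (x \in subalg).
Proof. exact: asboolP. Qed.

Lemma mem_subalg x : S x -> x \in subalg.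
Proof. by move=> Sx; apply/subalgP; apply: gen_subalg_gen. Qed.

Lemma subalg_is_closed : subalg_closed subalg.
Proof.
split=> [|k x y /subalgP Sx /subalgP Sy|x y /subalgP Sx /subalgP Sy];
  apply/subalgP.
- by rewrite -[1]scale1r; apply: gen_subalg_const.
- rewrite -mulr_algl; apply: gen_subalgD Sy.
  by apply: gen_subalgM Sx; apply: gen_subalg_const.
- exact: gen_subalgM.
Qed.

HB.instance Definition _ := GRing.isSubalgClosed.Build K A subalg
  subalg_is_closed.

Definition subalg_type := {x : A | x \in subalg}.

HB.instance Definition _ := SubChoice.on subalg_type.
HB.instance Definition _ :=
  [SubChoice_isSubAlgebra of subalg_type by <:].

Definition subalg_gen x (Sx : S x) : subalg_type :=
  exist _ x (mem_subalg Sx).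

Lemma subalg0 : 0 \in subalg.
Proof. exact: rpred0. Qed.

Lemma subalgZD k x y :
  x \in subalg -> y \in subalg -> k *: x + y \in subalg.
Proof. by have [_ SZD _] := subalg_is_closed; apply: SZD. Qed.

(* B \cap phi(B), where B is the subalgebra generated by S *)
Definition cap_image (phi : {lrmorphism A -> A}) : {pred A} :=
  fun x => (x \in subalg) && `[< exists2 y, y \in subalg & phi y = x >].

Lemma cap_imageP (phi : {lrmorphism A -> A}) x :
  reflect (x \in subalg /\ exists2 y, y \in subalg & phi y = x)
          (x \in cap_image phi).
Proof. by apply: (iffP andP) => -[Sx /asboolP]. Qed.

Lemma cap_image_is_closed (phi : {lrmorphism A -> A}) :
  submod_closed (cap_image phi).
Proof.
split=> [|k x y /cap_imageP[Sx [x' Sx' ex]] /cap_imageP[Sy [y' Sy' ey]]];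
  apply/cap_imageP.
  by split; [|exists 0]; rewrite ?raddf0 ?subalg0.
split; first exact: subalgZD.
by exists (k *: x' + y'); [exact: subalgZD | rewrite -ex -ey; exact: linearP].
Qed.

HB.instance Definition _ (phi : {lrmorphism A -> A}) :=
  GRing.isSubmodClosed.Build K A (cap_image phi) (cap_image_is_closed phi).

Definition cap_image_type (phi : {lrmorphism A -> A}) :=
  {x : A | x \in cap_image phi}.

HB.instance Definition _ (phi : {lrmorphism A -> A}) := SubChoice.on (cap_image_type phi).
HB.instance Definition _ (phi : {lrmorphism A -> A}) :=
  [SubChoice_isSubLmodule of cap_image_type phi by <:].

End GeneratedSubalgebra.

Section Modules.
Variables (K : fieldType) (A : algType K).

Definition is_left_module (V : lmodType K) (act : A -> V -> V) : Prop :=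
  [/\ (forall a, linear (act a)), (forall u, linear (act^~ u)),
      (forall u, act 1 u = u)
    & (forall a b u, act (a * b) u = act a (act b u))].

Definition is_right_module (V : lmodType K) (act : V -> A -> V) : Prop :=
  [/\ (forall a, linear (act^~ a)), (forall u, linear (act u)),
      (forall u, act u 1 = u)
    & (forall u a b, act u (a * b) = act (act u a) b)].

Definition left_linear (V W : lmodType K) (actV : A -> V -> V)
    (actW : A -> W -> W) (phi : V -> W) : Prop :=
  linear phi /\ forall a u, phi (actV a u) = actW a (phi u).

Definition right_linear (V W : lmodType K) (actV : V -> A -> V)
    (actW : W -> A -> W) (phi : V -> W) : Prop :=
  linear phi /\ forall u a, phi (actV u a) = actW (phi u) a.

End Modules.

(* Hom_Z(P, Z) *)
Definition dual (P : zmodType) := {additive P -> int}.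

Section Dual.
Variable P : zmodType.
Implicit Types h k : dual P.

HB.instance Definition _ := gen_eqMixin (dual P).
HB.instance Definition _ := gen_choiceMixin (dual P).

Definition pairing h (x : P) : int := (h : {additive P -> int}) x.

Lemma dualP h k : (forall x, pairing h x = pairing k x) -> h = k.
Proof.
rewrite /pairing; case: h k => [h [[hP]]] [k [[kP]]] /= /funext hk; subst k.
by rewrite (Prop_irrelevance hP kP).
Qed.

Definition dual_zero : dual P := \0 : {additive P -> int}.
Definition dual_opp h : dual P := (\- h) : {additive P -> int}.
Definition dual_add h k : dual P := (h \+ k) : {additive P -> int}.

Lemma dual_addA : associative dual_add.
Proof. by move=> h k l; apply: dualP => x; apply: addrA. Qed.

Lemma dual_addC : commutative dual_add.
Proof. by move=> h k; apply: dualP => x; apply: addrC. Qed.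

Lemma dual_add0 : left_id dual_zero dual_add.
Proof. by move=> h; apply: dualP => x; apply: add0r. Qed.

Lemma dual_addN : left_inverse dual_zero dual_opp dual_add.
Proof. by move=> h; apply: dualP => x; apply: addNr. Qed.

HB.instance Definition _ :=
  GRing.isZmodule.Build (dual P) dual_addA dual_addC dual_add0 dual_addN.

End Dual.

Definition Z_independent (P : zmodType) (J : eqType) (b : J -> P) : Prop :=
  forall (s : seq J) (c : J -> int), uniq s ->
    \sum_(j <- s) b j *~ c j = 0 -> forall j, j \in s -> c j = 0.

Definition Z_spanning (P : zmodType) (J : eqType) (b : J -> P) : Prop :=
  forall x, exists (s : seq J) (c : J -> int), x = \sum_(j <- s) b j *~ c j.

Definition free_abelian (P : zmodType) : Prop :=
  exists (J : choiceType) (b : J -> P), Z_independent b /\ Z_spanning b.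

Definition symmetrizable_GCM (I : eqType) (a : I -> I -> int) : Prop :=
  [/\ forall i, a i i = 2,
      forall i j, i != j -> a i j <= 0,
      forall i j, a i j = 0 -> a j i = 0
    & exists2 c : I -> rat, forall i, 0 < c i
        & forall i j, c i * (a i j)%:~R = c j * (a j i)%:~R].

Record cartan_datum (I : eqType) (P : zmodType) := CartanDatum {
  cartan : I -> I -> int;
  sroot : I -> P;
  scoroot : I -> dual P;
  form : P -> P -> rat;
  (* half_norm i = (alpha_i, alpha_i) / 2 *)
  half_norm : I -> nat;
  cartan_GCM : symmetrizable_GCM cartan;
  weight_free : free_abelian P;
  sroot_independent : Z_independent sroot;
  form_sym : forall x y, form x y = form y x;
  form_add : forall x y z, form (x + y) z = form x z + form y z;
  pairing_sroot : forall i j, pairing (scoroot i) (sroot j) = cartan i j;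
  half_norm_gt0 : forall i, (0 < half_norm i)%N;
  form_sroot : forall i, form (sroot i) (sroot i) = 2 * (half_norm i)%:R;
  pairing_form : forall i x,
    (pairing (scoroot i) x)%:~R
      = 2 * form (sroot i) x / form (sroot i) (sroot i);
  fundamental_weight : forall i, exists L : P,
    forall j, pairing (scoroot j) L = (j == i)%:R
}.

(* Q(q) *)
Definition Qq := {fraction {poly rat}}.
HB.instance Definition _ := GRing.Field.on Qq.
Definition q : Qq := tofrac 'X.

Section QuantumGroup.
Variables (I : eqType) (P : zmodType) (D : cartan_datum I P).

Local Notation a := (cartan D).
Local Notation alpha := (sroot D).
Local Notation hh := (scoroot D).
Local Notation d := (half_norm D).

Definition qi (i : I) : Qq := q ^+ d i.

Definition qint i (n : nat) : Qq :=
  (qi i ^+ n - qi i ^- n) / (qi i - (qi i)^-1).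

Definition qfact i (n : nat) : Qq := \prod_(1 <= m < n.+1) qint i m.

(* z^(s) with respect to q_i *)
Definition divpow (A : algType Qq) i (z : A) (s : nat) : A :=
  (qfact i s)^-1 *: z ^+ s.

Definition serre (A : algType Qq) (z : I -> A) i j : A :=
  let n := `|1 - a i j|%N in
  \sum_(s < n.+1)
     (-1) ^+ s *: (divpow i (z i) s * z j * divpow i (z i) (n - s)).

Definition refl i (h : dual P) : dual P := h - hh i *~ pairing h (alpha i).

Inductive Ugen := GenE of I | GenF of I | GenQ of dual P.

HB.instance Definition _ := gen_eqMixin Ugen.
HB.instance Definition _ := gen_choiceMixin Ugen.

Local Notation Ufree := (free_alg Qq Ugen).
Local Notation E i := (free_gen Qq (GenE i)).
Local Notation F i := (free_gen Qq (GenF i)).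
Local Notation Q h := (free_gen Qq (GenQ h)).

Inductive Urel : Ufree -> Ufree -> Prop :=
| Urel_q0 : Urel (Q 0) 1
| Urel_qD h k : Urel (Q h * Q k) (Q (h + k))
| Urel_qe h i : Urel (Q h * E i * Q (- h)) (q ^ pairing h (alpha i) *: E i)
| Urel_qf h i :
    Urel (Q h * F i * Q (- h)) (q ^ (- pairing h (alpha i)) *: F i)
| Urel_ef i j : Urel (E i * F j - F j * E i)
    (if i == j then
       (qi i - (qi i)^-1)^-1 *: (Q (hh i *+ d i) - Q (- (hh i *+ d i)))
     else 0)
| Urel_serre_e i j : i != j -> Urel (serre (fun k => E k) i j) 0
| Urel_serre_f i j : i != j -> Urel (serre (fun k => F k) i j) 0.

(* The counit vanishes on the ideal of relations, which is thus proper. *)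
Definition counit_gen (g : Ugen) : Qq := if g is GenQ _ then 1 else 0.

Definition counit_monom (m : {fmonom Ugen}) : Qq :=
  \prod_(g <- (m : seq Ugen)) counit_gen g.

Lemma counit_monom_morphism : mmorphism counit_monom.
Proof.
split=> [x y|]; rewrite /counit_monom; first by rewrite fmM big_cat.
by rewrite fm1 big_nil.
Qed.

HB.instance Definition _ := monalg.isMultiplicative.Build
  {fmonom Ugen} Qq counit_monom counit_monom_morphism.

Definition counit (x : Ufree) : Qq := mmap idfun counit_monom x.

Local Notation counitF := (mmap idfun counit_monom).

Lemma counitD x y : counit (x + y) = counit x + counit y.
Proof. by rewrite -[x + y]/(free_add x y) free_addE [LHS](raddfD counitF). Qed.
Lemma counitN x : counit (- x) = - counit x.
Proof. by rewrite -[- x]/(free_opp x) free_oppE [LHS](raddfN counitF). Qed.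
Lemma counitB x y : counit (x - y) = counit x - counit y.
Proof. by rewrite counitD counitN. Qed.
Lemma counit0 : counit 0 = 0.
Proof. by have := counitB 0 0; rewrite !subrr. Qed.
Lemma counitM x y : counit (x * y) = counit x * counit y.
Proof. by rewrite -[x * y]/(free_mul x y) free_mulE [LHS](rmorphM counitF). Qed.
Lemma counit1 : counit 1 = 1.
Proof. by rewrite -[1 in LHS]/free_one free_oneE [LHS](rmorph1 counitF). Qed.
Lemma counitZ k x : counit (k *: x) = k * counit x.
Proof. by rewrite -[k *: x]/(free_scale k x) free_scaleE [LHS]mmapZ. Qed.
Lemma counit_free_gen g : counit (free_gen Qq g) = counit_gen g.
Proof.
by rewrite free_genE /counit mmapU mul1r /= /counit_monom fmU big_seq1.
Qed.

Lemma counit_serre (z : I -> Ufree) i j :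
  counit (z j) = 0 -> counit (serre z i j) = 0.
Proof.
move=> zj0; rewrite /serre.
elim/big_rec: _ => [|s x _ x0]; first exact: counit0.
by rewrite counitD x0 counitZ !counitM zj0 mulr0 mul0r mulr0 addr0.
Qed.

Lemma Urel_counit x y : Urel x y -> counit x = counit y.
Proof.
case=> {x y} [|h k|h i|h i|i j|i j _|i j _].
- by rewrite counit_free_gen counit1.
- by rewrite counitM !counit_free_gen mulr1.
- by rewrite counitZ !counitM !counit_free_gen mulr0 mul0r mulr0.
- by rewrite counitZ !counitM !counit_free_gen mulr0 mul0r mulr0.
- rewrite counitB (counitM (E i)) (counitM (F j)) !counit_free_gen mulr0 subrr.
  case: (i == j); last by rewrite counit0.
  by rewrite counitZ counitB !counit_free_gen subrr mulr0.
- by rewrite counit0 counit_serre // counit_free_gen.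
- by rewrite counit0 counit_serre // counit_free_gen.
Qed.

Lemma Urel_proper : ~ gen_ideal Urel 1.
Proof.
have I0 x : gen_ideal Urel x -> counit x = 0.
  elim=> [{}x y /Urel_counit xy||{}x y _ x0 _ y0|b c {}x _ x0].
  - by rewrite counitB xy subrr.
  - exact: counit0.
  - by rewrite counitD x0 y0 addr0.
  - by rewrite !counitM x0 mulr0 mul0r.
by move=> /I0 /eqP; rewrite counit1 oner_eq0.
Qed.

(* U_q(g) *)
Definition Uq := quot_alg Urel_proper.
HB.instance Definition _ := GRing.Algebra.on Uq.

Definition Ue i : Uq := quot_pi Urel_proper (E i).
Definition Uf i : Uq := quot_pi Urel_proper (F i).
Definition Uqh h : Uq := quot_pi Urel_proper (Q h).
Definition Ut i : Uq := Uqh (hh i *+ d i).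
Definition Utinv i : Uq := Uqh (- (hh i *+ d i)).

Definition ad_f i (u : Uq) : Uq := Uf i * u - Ut i * u * Utinv i * Uf i.
Definition ad_e i (u : Uq) : Uq := Ue i * u * Ut i - u * Ue i * Ut i.
Definition ad_f_star i (u : Uq) : Uq := u * Uf i - Uf i * Ut i * u * Utinv i.
Definition ad_e_star i (u : Uq) : Uq :=
  Utinv i * u * Ue i - Utinv i * Ue i * u.

Inductive minus_gen : Uq -> Prop :=
| minus_f j : minus_gen (Uf j).

Inductive parabolic_gen i : Uq -> Prop :=
| parabolic_e : parabolic_gen i (Ue i)
| parabolic_f j : parabolic_gen i (Uf j)
| parabolic_q h : parabolic_gen i (Uqh h).

(* U_q(p_i) *)
Definition Up i := subalg_type (parabolic_gen i).
HB.instance Definition _ i := GRing.Algebra.on (Up i).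

Definition pe i : Up i := subalg_gen (parabolic_e i).
Definition pf i j : Up i := subalg_gen (parabolic_f i j).
Definition pq i h : Up i := subalg_gen (parabolic_q i h).

(* The automorphism T_i of U_q(g), together with its inverse; it is unique,
   since its values on generators are prescribed. *)
Record braid_symmetry (i : I) := BraidSymmetry {
  braid : {lrmorphism Uq -> Uq};
  braid_inv : {lrmorphism Uq -> Uq};
  braidK : cancel braid braid_inv;
  braid_invK : cancel braid_inv braid;
  braid_q : forall h, braid (Uqh h) = Uqh (refl i h);
  braid_ei : braid (Ue i) = - (Utinv i * Uf i);
  braid_fi : braid (Uf i) = - (Ue i * Ut i);
  braid_ej : forall j, j != i ->
    braid (Ue j) = \sum_(r < `|a i j|.+1)
      ((-1) ^+ r * qi i ^- r) *:
        (divpow i (Ue i) r * Ue j * divpow i (Ue i) (`|a i j| - r));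
  braid_fj : forall j, j != i ->
    braid (Uf j) = \sum_(r < `|a i j|.+1)
      ((-1) ^+ r * qi i ^+ r) *:
        (divpow i (Uf i) (`|a i j| - r) * Uf j * divpow i (Uf i) r)
}.

Section Intersections.
Variables (i : I) (T : braid_symmetry i).

(* U_i = U_q^- \cap T_i U_q^-  and  _iU = U_q^- \cap T_i^-1 U_q^- *)
Definition Ui := cap_image_type minus_gen (braid T).
Definition iU := cap_image_type minus_gen (braid_inv T).
HB.instance Definition _ := GRing.Lmodule.on Ui.
HB.instance Definition _ := GRing.Lmodule.on iU.

Lemma braid_iU (u : iU) : braid T (val u) \in cap_image minus_gen (braid T).
Proof.
case: u => u /= /cap_imageP[um [v vm ev]]; apply/cap_imageP.
by split; [rewrite -ev braid_invK | exists u].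
Qed.

Definition braid_res (u : iU) : Ui := exist _ (braid T (val u)) (braid_iU u).

Definition Ui_right_action (act : Ui -> Up i -> Ui) : Prop :=
  [/\ forall u, val (act u (pf i i)) = ad_e i (val u),
      forall u, val (act u (pe i)) = ad_f i (val u),
      forall u j, j != i -> val (act u (pf i j)) = val u * braid T (Uf j)
    & forall u h, val (act u (pq i h))
        = Uqh (- refl i h) * val u * Uqh (refl i h)].

Definition iU_left_action (act : Up i -> iU -> iU) : Prop :=
  [/\ forall u, val (act (pf i i) u) = ad_e_star i (val u),
      forall u, val (act (pe i) u) = ad_f_star i (val u),
      forall u j, j != i -> val (act (pf i j) u) = braid_inv T (Uf j) * val u
    & forall u h, val (act (pq i h) u)
        = Uqh (refl i h) * val u * Uqh (- refl i h)].

Definition Ui_left_action (act : Up i -> Ui -> Ui) : Prop :=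
  [/\ forall u, val (act (pf i i) u) = ad_f i (val u),
      forall u, val (act (pe i) u) = ad_e i (val u),
      forall u j, j != i -> val (act (pf i j) u) = Uf j * val u
    & forall u h, val (act (pq i h) u) = Uqh h * val u * Uqh (- h)].

Definition iU_right_action (act : iU -> Up i -> iU) : Prop :=
  [/\ forall u, val (act u (pf i i)) = ad_f_star i (val u),
      forall u, val (act u (pe i)) = ad_e_star i (val u),
      forall u j, j != i -> val (act u (pf i j)) = val u * Uf j
    & forall u h, val (act u (pq i h)) = Uqh (- h) * val u * Uqh h].

End Intersections.

End QuantumGroup.

(* Main.v *)
(* The left action of U_q(p_i) is x . u = sum x_(1) u S(pi(x_(2))), where pi
   kills the f_j with j <> i.  Neither a tensor product nor a presentation of
   U_q(p_i) is needed: U_q(g) acts on functions int -> U_q(g) by the adjoint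
   action, the degree recording the weight of the second tensor factor, and
   since U_q(p_i) never raises this degree, the degree-zero component is an
   action.  The right action is its mirror image under the anti-automorphism
   fixing e_i and f_i and sending q^h to q^-h; the two other structures are
   transported by T_i.

   Stability holds because U_i is the subalgebra generated by the
   ad_{f_i}^n(f_j), j <> i, which is visibly stable under ad_{e_i}, ad_{f_i}
   and contains f_j and T_i(f_j).  Indeed T_i(U_q^-) consists of polynomials in
   e_i t_i over this subalgebra, and such a polynomial lies in U_q^- only if it
   equals its constant term: the action graded by the height isolates its
   higher terms one at a time. *)
From HB Require Import structures.
Require Import Defs.
From mathcomp Require Import all_boot all_order all_algebra fraction.
From mathcomp Require Import boolp functions monalg.
From mathcomp Require Import ring zify.

Set Implicit Arguments.
Unset Strict Implicit.
Unset Printing Implicit Defensive.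

Import Order.TTheory GRing.Theory Num.Theory.
Local Open Scope ring_scope.

(** Killing f_j while keeping e_j contradicts the relation for [e_j, f_j], so the twisted action
    does not extend to U_q(g). As U_q(p_i) enters as a subalgebra, it cannot be prescribed on
    generators either. Hence the detour through a representation of all of U_q(g), restricted
    afterwards.

    Its hardest relations are the Serre relations, for operators that are sums of two terms. As an
    iterated q-commutator, with coefficients in either order, the Serre sum does not see a summand
    that q-commutes suitably with the rest; this is why q-binomial identities come into play.

    The same expansion identifies T_i(f_j) with ad_{f_i}^M(f_j) / [M]_i!, where M = -a_{i,j}. The
    sl2 relation between ad_{e_i} and ad_{f_i} shows that ad_{e_i} sends ad_{f_i}^n(f_j) to [n]_i
    [M + 1 - n]_i ad_{f_i}^{n-1}(f_j). As q is not a root of unity, one descends from T_i(f_j)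
    through the whole string inside T_i(U_q^-). This is one inclusion in the description of U_i; the
    other is the argument with polynomials in e_i t_i. *)

(** * Iterated q-commutators *)

Section IteratedCommutator.
Variables (K : fieldType) (A : algType K).
Implicit Types (x y z w : A) (c : nat -> K).

Fixpoint iter_qcomm z c w n : A :=
  if n is n'.+1
  then z * iter_qcomm z c w n' - c n' *: (iter_qcomm z c w n' * z) else w.

(* With these coefficients y q-commutes with every iterate, so that its
   contribution cancels at each step. *)
Lemma iter_qcomm_skew_add x y w c theta chi :
  y * w = theta *: (w * y) -> y * x = chi *: (x * y) ->
  (forall n, c n = theta * chi ^+ n) ->
  forall n, iter_qcomm (x + y) c w n = iter_qcomm x c w n.
Proof.
move=> yw yx cE.
have yP n : y * iter_qcomm x c w n = c n *: (iter_qcomm x c w n * y).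
  elim: n => [|n IHn] /=; first by rewrite cE mulr1.
  rewrite mulrBr -scalerAr !mulrA IHn yx -scalerAl -mulrA IHn.
  rewrite -scalerAl -(mulrA _ y x) yx -!scalerAr !scalerA mulrBl scalerBr.
  rewrite -!mulrA -scalerAl !scalerA !cE exprSr -!mulrA.
  by congr (_ *: _ - _ *: _); ring.
elim=> //= n ->.
by rewrite mulrDl mulrDr yP scalerDr opprD addrACA subrr addr0.
Qed.

Lemma iter_qcomm_skew_mul z w x y c theta chi :
  x * w = theta *: (w * x) -> x * z = chi *: (z * x) ->
  y * z = theta *: (z * y) -> x * y = y * x ->
  forall n, exists k, iter_qcomm (z * x) c (w * y) n
    = k *: (iter_qcomm z c w n * x ^+ n * y).
Proof.
move=> xw xz yz xy n.
have xP m : x * iter_qcomm z c w m = (theta * chi ^+ m) *: (iter_qcomm z c w m * x).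
  elim: m => [|m IHm] /=; first by rewrite mulr1.
  rewrite mulrBr -scalerAr !mulrA xz IHm -!scalerAl -!mulrA IHm xz.
  rewrite -!scalerAr !scalerA mulrBl scalerBr -scalerAl scalerA -!mulrA.
  by congr (_ *: _ - _ *: _); rewrite exprSr; ring.
have xnz m : x ^+ m * z = chi ^+ m *: (z * x ^+ m).
  elim: m => [|m IHm]; first by rewrite !expr0 mul1r mulr1 scale1r.
  rewrite {1}exprS -mulrA IHm -scalerAr !mulrA xz -scalerAl scalerA -exprSr.
  by rewrite -mulrA -exprS.
have yx m : x ^+ m * y = y * x ^+ m by apply/esym/commrX; apply/esym.
elim: n => [|n [k IHn]] /=; first by exists 1; rewrite expr0 mulr1 scale1r.
exists (k * (theta * chi ^+ n)); rewrite {}IHn -scalerA; set p := iter_qcomm _ _ _ n.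
have zxp : z * x * (p * x ^+ n * y) = (theta * chi ^+ n) *: (z * p * x ^+ n.+1 * y).
  rewrite -[z * x * _]mulrA !mulrA -[z * x * p]mulrA xP -!(scalerAl, scalerAr).
  by rewrite exprS !mulrA.
have pzx : p * x ^+ n * y * (z * x) = (theta * chi ^+ n) *: (p * z * x ^+ n.+1 * y).
  rewrite mulrA -[_ * y * z]mulrA yz -!(scalerAl, scalerAr) -[RHS]scalerA.
  congr (_ *: _); rewrite mulrA -[p * _ * z]mulrA xnz -!(scalerAl, scalerAr).
  by congr (_ *: _); rewrite exprSr -!mulrA xy.
rewrite -scalerAr -scalerAl zxp pzx /=; set r := theta * _.
rewrite [c n *: (k *: _)]scalerA [c n * k]mulrC -[k * _ *: _]scalerA.
rewrite [c n *: (r *: _)]scalerA [c n * r]mulrC -[r * _ *: _]scalerA -!scalerBr.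
by rewrite !mulrBl -!scalerAl.
Qed.

End IteratedCommutator.

(** * The q-binomial expansion of an iterated q-commutator *)

Section QuantumBinomial.
Variables (K : fieldType) (A : algType K) (g : nat -> K) (v y : K).
Hypothesis g_neq0 : forall n, g n.+1 != 0.
Hypothesis gD : forall s t, v ^+ s * g (s + t)%N = g t + v ^+ (s + t) * g s.

Let fact n := \prod_(1 <= m < n.+1) g m.

Let factS n : fact n.+1 = fact n * g n.+1.
Proof. by rewrite /fact big_nat_recr. Qed.

Let fact_neq0 n : fact n != 0.
Proof.
elim: n => [|n IHn]; first by rewrite /fact big_geq ?oner_neq0.
by rewrite factS mulf_neq0.
Qed.

(** Extended by zero beyond M: with truncated subtraction the formula would in general not vanish at
    s = M + 1, where the recursion needs it to. *)
Let coef M s := if (s <= M)%N then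
  (- y) ^+ s * v ^+ (M * s) * (fact M / (fact s * fact (M - s))) else 0.

Let coef0 M : coef M 0 = 1.
Proof.
rewrite /coef muln0 !expr0 subn0 !mul1r.
by rewrite [fact 0]big_geq // mul1r divff.
Qed.

(** Pascal's rule for (-y)^s v^(M s) times the q-binomial coefficient; for s < M, [gD] splits the
    numerator into the two terms. *)
Let coefS M s :
  coef M.+1 s.+1 = coef M s.+1 - y * v ^+ (2 * M).+1 * coef M s.
Proof.
rewrite /coef ltnS subSS; have [ltsM|leMs] := ltnP s M.
  rewrite (ltnW ltsM).
  have [t ->] : exists t, M = (s + t).+1.
    by exists (M - s.+1)%N; rewrite -addSn subnKC.
  rewrite subSS addKn subSn ?leq_addr // addKn !factS.
  have := gD s.+1 t.+1; rewrite addSn addnS => gE.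
  have vE : v ^+ ((s + t).+2 * s.+1) = v ^+ ((s + t).+1 * s.+1) * v ^+ s.+1.
    by rewrite -exprD mulSnr.
  rewrite vE.
  transitivity ((- y) ^+ s.+1 * v ^+ ((s + t).+1 * s.+1) *
    (fact (s + t) * g (s + t).+1 * (v ^+ s.+1 * g (s + t).+2)
      / (fact s * g s.+1 * (fact t * g t.+1)))); first by field; rewrite !fact_neq0 !g_neq0.
  rewrite gE mulrDr mulrDl mulrDr; congr (_ + _).
    by field; rewrite !fact_neq0 !g_neq0.
  have -> : v ^+ ((s + t).+1 * s.+1) = v ^+ ((s + t).+1 * s) * v ^+ (s + t).+1.
    by rewrite -exprD mulnS addnC.
  have -> : v ^+ (2 * (s + t).+1).+1 = v ^+ (s + t).+1 * v ^+ (s + t).+2.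
    by rewrite -exprD addnS mul2n addnn.
  by rewrite exprSr; field; rewrite !fact_neq0 !g_neq0.
have [->|neqsM] := eqVneq s M; last first.
  by rewrite leqNgt ltn_neqAle eq_sym neqsM leMs /= mulr0 subrr.
rewrite leqnn subnn [fact 0]big_geq // !mulr1 !divff // !mulr1 sub0r.
rewrite exprS !mulNr; congr (- _); rewrite -!mulrA; congr (_ * _).
rewrite mulrCA -exprD; congr (_ * _ ^+ _); lia.
Qed.

Let coef_gt M : coef M M.+1 = 0.
Proof. by rewrite /coef ltnn. Qed.

(** [g] stands for the quantum integers. Only [gD] is asked of it because [n]_i satisfies it both
    for v = q_i and for v = q_i^-1, and both signs occur below. *)
Lemma iter_qcommE (z w : A) M :
  iter_qcomm z (fun n => y * v ^+ (2 * n).+1) w M =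
  fact M *: \sum_(s < M.+1) ((- y) ^+ s * v ^+ (M * s)) *:
    (((fact (M - s))^-1 *: z ^+ (M - s)) * w * ((fact s)^-1 *: z ^+ s)).
Proof.
transitivity (\sum_(0 <= s < M.+1) coef M s *: (z ^+ (M - s) * w * z ^+ s)).
  elim: M => [|M /= ->].
    by rewrite big_nat1 coef0 !expr0 mul1r mulr1 scale1r.
  have coefZ s : coef M.+1 s.+1 *: (z ^+ (M.+1 - s.+1) * w * z ^+ s.+1)
      = coef M s.+1 *: (z ^+ (M - s) * w * z ^+ s.+1)
        - (y * v ^+ (2 * M).+1) *: (coef M s *: (z ^+ (M - s) * w * z ^+ s) * z).
    by rewrite coefS scalerBl subSS -scalerAl scalerA -!mulrA -exprSr.
  rewrite [RHS]big_nat_recl // coef0 [in RHS](eq_bigr _ (fun s _ => coefZ s)).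
  rewrite sumrB -scaler_sumr -mulr_suml addrA; congr (_ - _).
  rewrite [in RHS]big_nat_recr //= coef_gt scale0r addr0.
  rewrite mulr_sumr big_nat_recl // coef0 -scalerAr !scale1r; congr (_ + _).
    by rewrite !subn0 exprS !mulrA.
  apply: eq_big_nat => s /andP[_ ltsM].
  by rewrite -scalerAr !mulrA -exprS subnSK.
rewrite big_mkord scaler_sumr; apply: eq_bigr => s _.
rewrite /coef -ltnS ltn_ord -!scalerAl -!scalerAr !scalerA; congr (_ *: _).
by field; rewrite !fact_neq0.
Qed.

End QuantumBinomial.

(** * Quantum integers, and Serre relations as iterated q-commutators *)

Lemma exprNV_mul (K : fieldType) (v : K) n s : v != 0 ->
  (- v ^- n) ^+ s * v ^+ (n * s) = (-1) ^+ s.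
Proof.
move=> v_neq0; rewrite [in LHS]exprNn -mulrA exprVn exprM mulVf ?mulr1 //.
by rewrite !expf_neq0.
Qed.

Lemma exprVS_odd (K : fieldType) (v : K) m k : v != 0 ->
  v ^- m.+1 * v ^+ (2 * k).+1 = v ^- m * (v ^+ 2) ^+ k.
Proof.
move=> v_neq0; rewrite exprS invfM mulrAC exprS !mulrA mulVf // mul1r.
by rewrite mulrC exprM.
Qed.

Section GaussIntegers.
Variables (K : fieldType) (v : K).
Hypotheses (v_neq0 : v != 0) (v_subV : v - v^-1 != 0).

Let gauss n := (v ^+ n - v ^- n) / (v - v^-1).

Let v_sqr : v * v - 1 != 0.
Proof.
have -> : v * v - 1 = v * (v - v^-1) by rewrite mulrBr divff.
by rewrite mulf_neq0.
Qed.

Lemma gaussD s t : v ^+ s * gauss (s + t) = gauss t + v ^+ (s + t) * gauss s.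
Proof. by rewrite /gauss !exprD; field; rewrite v_neq0 v_sqr !expf_neq0. Qed.

Lemma gaussDV s t :
  v^-1 ^+ s * gauss (s + t) = gauss t + v^-1 ^+ (s + t) * gauss s.
Proof.
by rewrite /gauss !exprD !exprVn; field; rewrite v_neq0 v_sqr !expf_neq0.
Qed.

End GaussIntegers.

Lemma q_neq0 : q != 0.
Proof. by rewrite tofrac_eq0 polyX_eq0. Qed.

Lemma q_expn_neq1 n : q ^+ n.+1 != 1.
Proof.
rewrite -tofracXn -tofrac1 tofrac_eq.
apply/eqP => /(congr1 (fun p : {poly rat} => size p)).
by rewrite size_polyXn size_poly1.
Qed.

Section QuantumIntegers.
Variables (I : eqType) (P : zmodType) (D : cartan_datum I P).

Local Notation a := (cartan D).
Local Notation d := (half_norm D).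
Local Notation qi := (qi D).

Lemma qi_neq0 i : qi i != 0.
Proof. by rewrite expf_neq0 ?q_neq0. Qed.

Lemma qi_expn_neq1 i n : qi i ^+ n.+1 != 1.
Proof.
rewrite -exprM; case E: (_ * _)%N => [|m]; last exact: q_expn_neq1.
by move/eqP: E; rewrite muln_eq0 eqn0Ngt half_norm_gt0.
Qed.

Lemma qi_subV_neq0 i : qi i - (qi i)^-1 != 0.
Proof.
rewrite subr_eq0; apply: contra (qi_expn_neq1 i 1) => /eqP qE.
by rewrite expr2 {2}qE divff ?qi_neq0.
Qed.

Lemma qint_neq0 i n : qint D i n.+1 != 0.
Proof.
rewrite mulf_neq0 ?invr_eq0 ?qi_subV_neq0 // subr_eq0.
apply: contra (qi_expn_neq1 i (2 * n).+1) => /eqP qE.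
have -> : (2 * n).+2 = (n.+1 + n.+1)%N by lia.
by rewrite exprD {2}qE divff // expf_neq0 // qi_neq0.
Qed.

Lemma qfact_neq0 i n : qfact D i n != 0.
Proof.
rewrite prodf_seq_neq0; apply/allP => -[|m];
  by rewrite mem_index_iota ?qint_neq0.
Qed.

Lemma qintD i s t :
  qi i ^+ s * qint D i (s + t) = qint D i t + qi i ^+ (s + t) * qint D i s.
Proof. exact: gaussD (qi_neq0 i) (qi_subV_neq0 i) s t. Qed.

Lemma qintDV i s t :
  (qi i)^-1 ^+ s * qint D i (s + t) = qint D i t + (qi i)^-1 ^+ (s + t) * qint D i s.
Proof. exact: gaussDV (qi_neq0 i) (qi_subV_neq0 i) s t. Qed.

(** This is (alpha_i, alpha_j), as an integer so that it can be an exponent of q. *)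
Definition bform i j : int := a i j *+ d i.

Lemma bform_sym i j : bform i j = bform j i.
Proof.
apply: (@intr_inj rat); rewrite /bform !rmorphMn /= -!pairing_sroot !pairing_form.
rewrite !form_sroot (form_sym D (sroot D j)).
have dn k : (d k)%:R != 0 :> rat by rewrite pnatr_eq0 -lt0n half_norm_gt0.
by rewrite -mulr_natr -[in RHS]mulr_natr; field; rewrite !dn.
Qed.

Lemma q_bform i j : q ^ bform i j = qi i ^ a i j.
Proof. by rewrite /bform [qi i]exprnP exprz_exp -mulr_natr natz mulrC. Qed.

Lemma cartan_abs i j : i != j -> a i j = - (`|a i j|%N : int).
Proof.
by have [_ a_le0 _ _] := cartan_GCM D => /a_le0 ?; lia.
Qed.

Lemma cartan_abs1 i j : i != j -> `|1 - a i j|%N = `|a i j|.+1.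
Proof. by move=> /cartan_abs ?; lia. Qed.

Lemma q_bform_neq i j : i != j -> q ^ bform i j = qi i ^- `|a i j|.
Proof. by move=> ij; rewrite q_bform {1}cartan_abs // -invr_expz. Qed.

Lemma q_bform_ii i : q ^ bform i i = qi i ^+ 2.
Proof. by rewrite q_bform; have [-> _ _ _] := cartan_GCM D. Qed.

Definition serre_op (A : algType Qq) i (z w : A) n : A :=
  \sum_(s < n.+1) (-1) ^+ s *: (divpow D i z s * w * divpow D i z (n - s)).

Lemma serre_op_rev (A : algType Qq) i (z w : A) n :
  serre_op i z w n = (-1) ^+ n *:
    \sum_(s < n.+1) (-1) ^+ s *: (divpow D i z (n - s) * w * divpow D i z s).
Proof.
rewrite /serre_op (reindex_inj rev_ord_inj) scaler_sumr; apply: eq_bigr => s _ /=.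
have les : (s <= n)%N by rewrite -ltnS.
rewrite subSS subKn // scalerA; congr (_ *: _).
have -> : (-1 : Qq) ^+ n = (-1) ^+ (n - s) * (-1) ^+ s by rewrite -exprD subnK.
by rewrite -mulrA -expr2 sqrr_sign mulr1.
Qed.

Lemma serre_opD (A : algType Qq) i (z w w' : A) n :
  serre_op i z (w + w') n = serre_op i z w n + serre_op i z w' n.
Proof.
rewrite /serre_op -big_split; apply: eq_bigr => s _ /=.
by rewrite mulrDr mulrDl scalerDr.
Qed.

(** With y = v^-n the powers of v in the q-binomial expansion cancel and only signs remain: the
    Serre sum read backwards, whence the factor (-1)^n. *)
Lemma serre_op_iter_qcomm (A : algType Qq) i (z w : A) (v : Qq) n :
  v \in [:: qi i; (qi i)^-1] ->
  iter_qcomm z (fun k => v ^- n * v ^+ (2 * k).+1) w n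
    = ((-1) ^+ n * qfact D i n) *: serre_op i z w n.
Proof.
move=> vq.
have v_neq0 : v != 0.
  by move: vq; rewrite !inE => /orP[] /eqP ->; rewrite ?invr_eq0 qi_neq0.
have gD s t : v ^+ s * qint D i (s + t) = qint D i t + v ^+ (s + t) * qint D i s.
  by move: vq; rewrite !inE => /orP[] /eqP ->; rewrite ?qintD ?qintDV.
rewrite (iter_qcommE (v ^- n) (@qint_neq0 i) gD) serre_op_rev.
rewrite scalerA mulrAC -expr2 sqrr_sign mul1r; congr (_ *: _).
apply: eq_bigr => s _; congr (_ *: _).
exact: exprNV_mul.
Qed.

(* The q-commutator coefficients may be taken in increasing or in decreasing
   order, according to the sign [e]. *)
Lemma serre_op_eq0 (A : algType Qq) i j (z w : A) (e : bool) : i != j ->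
  serre_op i z w `|1 - a i j| = 0 <->
  iter_qcomm z
    (fun k => q ^ ((-1) ^+ e * bform i j) * (q ^ ((-1) ^+ e * bform i i)) ^+ k)
    w `|1 - a i j| = 0.
Proof.
move=> ij; set m := `|_|%N; set c := (X in iter_qcomm _ X).
pose v : Qq := if e then (qi i)^-1 else qi i.
have vq : v \in [:: qi i; (qi i)^-1] by rewrite /v !inE; case: (e); rewrite eqxx ?orbT.
have v_neq0 : v != 0 by rewrite /v; case: (e); rewrite ?invr_eq0 qi_neq0.
have vij : q ^ ((-1) ^+ e * bform i j) = v ^- `|a i j|.
  rewrite /v; case: (e); last by rewrite expr0 mul1r q_bform_neq.
  by rewrite expr1 mulN1r -invr_expz q_bform_neq // exprVn.
have vii : q ^ ((-1) ^+ e * bform i i) = v ^+ 2.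
  rewrite /v; case: (e); last by rewrite expr0 mul1r q_bform_ii.
  by rewrite expr1 mulN1r -invr_expz q_bform_ii exprVn.
(* Since m = |a_ij| + 1, the coefficient v^-|a_ij| v^(2k) has the odd exponent form required by the
   expansion. *)
have cE : c = fun k => v ^- m * v ^+ (2 * k).+1.
  by apply/funext => k; rewrite /c vij vii /m cartan_abs1 // exprVS_odd.
rewrite cE (@serre_op_iter_qcomm _ i) //; split=> [-> | /eqP]; first by rewrite scaler0.
by rewrite scaler_eq0 mulf_eq0 signr_eq0 (negPf (qfact_neq0 i m)) => /eqP.
Qed.

(** The Serre sum is linear in its middle entry x_j + y_j. On x_j the summand y_i drops out of the
    iterated q-commutator with negative exponents, on y_j the summand x_i drops out of the one with
    positive exponents. *)
Lemma serre_add (A : algType Qq) (x y : I -> A) i j : i != j ->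
  (forall k l, y k * x l = q ^ (- bform k l) *: (x l * y k)) ->
  serre D x i j = 0 -> serre D y i j = 0 ->
  serre D (fun k => x k + y k) i j = 0.
Proof.
rewrite -![serre _ _ _ _]/(serre_op _ _ _ _) => ij yx Sx Sy.
rewrite serre_opD.
have xy k l : x k * y l = q ^ (bform k l) *: (y l * x k).
  by rewrite yx scalerA bform_sym -expfzDr ?q_neq0 // subrr scale1r.
have -> : serre_op i (x i + y i) (x j) `|1 - a i j| = 0.
  apply/(serre_op_eq0 _ _ true ij).
  rewrite (iter_qcomm_skew_add (yx i j) (yx i i)) => [|n]; last by rewrite !mulN1r.
  exact/(serre_op_eq0 _ _ true ij).
rewrite add0r; apply/(serre_op_eq0 _ _ false ij); rewrite [x i + _]addrC.
rewrite (iter_qcomm_skew_add (xy i j) (xy i i)) => [|n]; last by rewrite !mul1r.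
exact/(serre_op_eq0 _ _ false ij).
Qed.

Lemma serre_twist (A : algType Qq) (z x : I -> A) (r : I -> I -> Qq) i j :
  i != j ->
  (forall k l, x k * z l = r k l *: (z l * x k)) ->
  (forall k l, x k * x l = x l * x k) -> r i j = r j i ->
  serre D z i j = 0 -> serre D (fun k => z k * x k) i j = 0.
Proof.
rewrite -![serre _ _ _ _]/(serre_op _ _ _ _) => ij xz xx rij Sz.
apply/(serre_op_eq0 _ _ false ij).
have xzji : x j * z i = r i j *: (z i * x j) by rewrite rij.
move/(serre_op_eq0 _ _ false ij): Sz => Sz.
have [k ->] := iter_qcomm_skew_mul
  (fun k => q ^ ((-1) ^+ false * bform i j)
            * (q ^ ((-1) ^+ false * bform i i)) ^+ k)
   (xz i j) (xz i i) xzji (xx i j) `|1 - a i j|%N.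
by rewrite Sz !mul0r scaler0.
Qed.

End QuantumIntegers.

(** * Universal property of U_q(g) *)

Section FreeEvaluation.
Variables (K : fieldType) (G : choiceType) (B : algType K) (phi : G -> B).

Definition eval_monom (m : {fmonom G}) : B := \prod_(g <- (m : seq G)) phi g.

Lemma eval_monom_morphism : mmorphism eval_monom.
Proof.
split=> [x y|]; rewrite /eval_monom; first by rewrite fmM big_cat.
by rewrite fm1 big_nil.
Qed.

HB.instance Definition _ := monalg.isMultiplicative.Build
  {fmonom G} B eval_monom eval_monom_morphism.

Definition free_eval (x : free_alg K G) : B := mmap (in_alg B) eval_monom x.

Let evalF : {malg K[{fmonom G}]} -> B := mmap (in_alg B) eval_monom.

Lemma free_eval_is_zmod_morphism : zmod_morphism free_eval.
Proof.
move=> x y; rewrite -[x - y]/(free_add x (free_opp y)) free_addE free_oppE.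
exact: (raddfB evalF).
Qed.

HB.instance Definition _ :=
  GRing.isZmodMorphism.Build _ _ free_eval free_eval_is_zmod_morphism.

Lemma free_eval_is_monoid_morphism : monoid_morphism free_eval.
Proof.
have [] := @commr_mmap_is_multiplicative _ _ _ (in_alg B) eval_monom.
  by move=> g m m'; rewrite /GRing.comm mulr_algl mulr_algr.
move=> evM ev1; split=> [|x y].
  by rewrite -[1 in LHS]/free_one free_oneE [LHS]ev1.
by rewrite -[x * y]/(free_mul x y) free_mulE [LHS]evM.
Qed.

HB.instance Definition _ :=
  GRing.isMonoidMorphism.Build _ _ free_eval free_eval_is_monoid_morphism.

Lemma free_eval_is_scalable : scalable free_eval.
Proof.
move=> k x; rewrite -[k *: x in LHS]/(free_scale k x) free_scaleE.
by rewrite /free_eval mmapZ mulr_algl.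
Qed.

HB.instance Definition _ :=
  GRing.isScalable.Build K _ _ *:%R free_eval free_eval_is_scalable.

Lemma free_eval_gen g : free_eval (free_gen K g) = phi g.
Proof.
by rewrite free_genE /free_eval mmapU /= scale1r mul1r /eval_monom fmU big_seq1.
Qed.

End FreeEvaluation.

Section UniversalProperty.
Variables (I : eqType) (P : zmodType) (D : cartan_datum I P) (B : algType Qq).

Lemma serre_morph (A : algType Qq) (f : {lrmorphism A -> B}) (z : I -> A) i j :
  f (serre D z i j) = serre D (fun k => f (z k)) i j.
Proof.
rewrite /serre linear_sum; apply: eq_bigr => s _.
by rewrite /= linearZ !rmorphM /divpow /= !linearZ /= !rmorphXn.
Qed.

Variables (E F : I -> B) (Q : dual P -> B).
Hypotheses (Q0 : Q 0 = 1) (QD : forall h k, Q h * Q k = Q (h + k)).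
Hypothesis QE : forall h i,
  Q h * E i * Q (- h) = q ^ pairing h (sroot D i) *: E i.
Hypothesis QF : forall h i,
  Q h * F i * Q (- h) = q ^ (- pairing h (sroot D i)) *: F i.
Hypothesis EF : forall i j, E i * F j - F j * E i = if i == j then
  (qi D i - (qi D i)^-1)^-1 *: (Q (scoroot D i *+ half_norm D i)
                                - Q (- (scoroot D i *+ half_norm D i))) else 0.
Hypothesis serreE : forall i j, i != j -> serre D E i j = 0.
Hypothesis serreF : forall i j, i != j -> serre D F i j = 0.

Let gen_image (g : Ugen I P) : B :=
  match g with GenE i => E i | GenF i => F i | GenQ h => Q h end.

Let ev : free_alg Qq (Ugen I P) -> B := free_eval gen_image.

Let ev_rel x y : Urel D x y -> ev x = ev y.
Proof.
case=> {x y} [|h k|h i|h i|i j|i j ij|i j ij]; rewrite /ev.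
- by rewrite free_eval_gen rmorph1.
- by rewrite rmorphM /= !free_eval_gen /= QD.
- by rewrite linearZ_LR !rmorphM /= !free_eval_gen /= QE.
- by rewrite linearZ_LR !rmorphM /= !free_eval_gen /= QF.
- rewrite rmorphB !rmorphM /= !free_eval_gen /= EF.
  case: eqP => _; last by rewrite rmorph0.
  by rewrite linearZ_LR rmorphB /= !free_eval_gen.
- rewrite rmorph0 serre_morph -[RHS](serreE ij); congr serre.
  by apply/funext => k; exact: free_eval_gen.
- rewrite rmorph0 serre_morph -[RHS](serreF ij); congr serre.
  by apply/funext => k; exact: free_eval_gen.
Qed.

Let ev_ideal x : gen_ideal (Urel D) x -> ev x = 0.
Proof.
elim=> [{}x y /ev_rel xy||{}x y _ x0 _ y0|b c {}x _ x0].
- by rewrite /ev rmorphB [X in X - _]xy subrr.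
- exact: rmorph0.
- by rewrite /ev rmorphD [X in X + _]x0 [X in _ + X]y0 addr0.
- by rewrite /ev !rmorphM [X in _ * X * _]x0 mulr0 mul0r.
Qed.

Let lift (u : Uq D) : B := ev (repr u).

Let lift_pi x : lift (quot_pi (Urel_proper (D := D)) x) = ev x.
Proof.
apply/eqP; rewrite -subr_eq0 -[_ - _](rmorphB (free_eval gen_image)).
by apply/eqP/ev_ideal/quot_pi_repr.
Qed.

Lemma Uq_lift : exists f : {lrmorphism Uq D -> B},
  [/\ forall i, f (Ue D i) = E i, forall i, f (Uf D i) = F i
    & forall h, f (Uqh D h) = Q h].
Proof.
have lift_zmod : zmod_morphism lift.
  move=> u v; rewrite -(quot_reprK u) -(quot_reprK v) -rmorphB !lift_pi.
  exact: rmorphB.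
have lift_monoid : monoid_morphism lift.
  split=> [|u v].
    rewrite -[1](rmorph1 (quot_pi (Urel_proper (D := D)))) lift_pi.
    by rewrite /ev rmorph1.
  rewrite -(quot_reprK u) -(quot_reprK v) -rmorphM !lift_pi.
  exact: rmorphM.
have lift_scale : scalable lift.
  move=> k u; rewrite -(quot_reprK u) -linearZ !lift_pi; exact: linearZ.
pose f1 := GRing.isZmodMorphism.Build _ _ lift lift_zmod.
pose f2 := GRing.isMonoidMorphism.Build _ _ lift lift_monoid.
pose f3 := GRing.isScalable.Build Qq _ _ *:%R lift lift_scale.
pose f : {lrmorphism Uq D -> B} := HB.pack lift f1 f2 f3.
by exists f; split=> ?; rewrite [LHS]lift_pi [LHS]free_eval_gen.
Qed.

End UniversalProperty.

(** * The algebra of linear endomorphisms of functions int -> A *)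

Definition graded_end (K : fieldType) (A : algType K) :=
  {linear (int -> A) -> (int -> A)}.

Section GradedEndomorphisms.
Variables (K : fieldType) (A : algType K).
Local Notation V := (int -> A).
Local Notation End := (graded_end A).
Implicit Types f g h : End.

HB.instance Definition _ := gen_eqMixin End.
HB.instance Definition _ := gen_choiceMixin End.

Definition endapp f (u : V) : V := (f : {linear V -> V}) u.

Lemma endappP f g : (forall u, endapp f u = endapp g u) -> f = g.
Proof.
rewrite /endapp; case: f g => [f [[fP] [fS]]] [g [[gP] [gS]]] /= /funext fg; subst g.
by rewrite (Prop_irrelevance fP gP) (Prop_irrelevance fS gS).
Qed.

Definition end_zero : End := (\0 : {linear V -> V}).
Definition end_opp f : End := (\- f : {linear V -> V}).
Definition end_add f g : End := (f \+ g : {linear V -> V}).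
Definition end_one : End := (idfun : {linear V -> V}).
Definition end_mul f g : End := (f \o g : {linear V -> V}).
Definition end_scale (k : K) f : End := (k \*: f : {linear V -> V}).

Lemma end_addA : associative end_add.
Proof. by move=> f g h; apply: endappP => u; apply: addrA. Qed.
Lemma end_addC : commutative end_add.
Proof. by move=> f g; apply: endappP => u; apply: addrC. Qed.
Lemma end_add0 : left_id end_zero end_add.
Proof. by move=> f; apply: endappP => u; apply: add0r. Qed.
Lemma end_addN : left_inverse end_zero end_opp end_add.
Proof. by move=> f; apply: endappP => u; apply: addNr. Qed.

HB.instance Definition _ :=
  GRing.isZmodule.Build End end_addA end_addC end_add0 end_addN.

Lemma end_mulA : associative end_mul.
Proof. by move=> f g h; apply: endappP. Qed.
Lemma end_mul1 : left_id end_one end_mul.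
Proof. by move=> f; apply: endappP. Qed.
Lemma end_mulr1 : right_id end_one end_mul.
Proof. by move=> f; apply: endappP. Qed.
Lemma end_mulDl : left_distributive end_mul end_add.
Proof. by move=> f g h; apply: endappP. Qed.
Lemma end_mulDr : right_distributive end_mul end_add.
Proof. by move=> f g h; apply: endappP => u; apply: (raddfD (f : {linear V -> V})). Qed.
Lemma end_oner_neq0 : end_one != end_zero.
Proof.
apply/eqP => /(congr1 (fun f : End => endapp f (fun=> 1) 0)) /eqP.
by rewrite (oner_eq0 A).
Qed.

HB.instance Definition _ := GRing.Zmodule_isNzRing.Build End
  end_mulA end_mul1 end_mulr1 end_mulDl end_mulDr end_oner_neq0.

Lemma end_scaleA k l f : end_scale k (end_scale l f) = end_scale (k * l) f.
Proof. by apply: endappP => u; apply: scalerA. Qed.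
Lemma end_scale1 : left_id 1 end_scale.
Proof. by move=> f; apply: endappP => u; apply: scale1r. Qed.
Lemma end_scaleDr : right_distributive end_scale +%R.
Proof. by move=> k f g; apply: endappP => u; apply: scalerDr. Qed.
Lemma end_scaleDl f : {morph end_scale^~ f : k l / k + l}.
Proof. by move=> k l; apply: endappP => u; apply: scalerDl. Qed.

HB.instance Definition _ := GRing.Zmodule_isLmodule.Build K End
  end_scaleA end_scale1 end_scaleDr end_scaleDl.

Lemma end_scaleAl k f g : k *: (f * g) = (k *: f) * g.
Proof. by apply: endappP. Qed.

HB.instance Definition _ := GRing.Lmodule_isLalgebra.Build K End end_scaleAl.

Lemma end_scaleAr k f g : k *: (f * g) = f * (k *: g).
Proof.
by apply: endappP => u; apply/esym/(linearZ_LR (f : {linear V -> V})).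
Qed.

HB.instance Definition _ := GRing.Lalgebra_isAlgebra.Build K End end_scaleAr.

Lemma endappD f g u : endapp (f + g) u = endapp f u + endapp g u.
Proof. by []. Qed.
Lemma endappM f g u : endapp (f * g) u = endapp f (endapp g u).
Proof. by []. Qed.
Lemma endapp1 u : endapp 1 u = u.
Proof. by []. Qed.
Lemma endappZ k f u : endapp (k *: f) u = k *: endapp f u.
Proof. by []. Qed.
Lemma endapp_linear f : linear (endapp f).
Proof. by move=> k u v; rewrite /endapp linearP. Qed.

Lemma endappBE f g u n : endapp (f - g) u n = endapp f u n - endapp g u n.
Proof. by []. Qed.

(** The operator of x # y # z^-m, from the tensor product of A, its opposite and the Laurent
    polynomials in the shift z. *)
Definition sandwich_fun (x y : A) (m : int) (u : V) : V :=
  fun n => x * u (n + m) * y.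

Lemma sandwich_fun_linear x y m : linear (sandwich_fun x y m).
Proof.
move=> k u v; apply/funext => n; rewrite /sandwich_fun !fctE /=.
by rewrite mulrDr mulrDl -scalerAr -scalerAl.
Qed.

HB.instance Definition _ x y m := GRing.isLinear.Build K V V *:%R
  (sandwich_fun x y m) (sandwich_fun_linear x y m).

Definition sandwich x y m : End := (sandwich_fun x y m : {linear V -> V}).

Lemma sandwichE x y m u n : endapp (sandwich x y m) u n = x * u (n + m) * y.
Proof. by []. Qed.

Lemma sandwich1 : sandwich 1 1 0 = 1.
Proof.
apply: endappP => u; apply/funext => n.
by rewrite sandwichE addr0 mul1r mulr1.
Qed.

Lemma sandwichM x y m x' y' m' :
  sandwich x y m * sandwich x' y' m' = sandwich (x * x') (y' * y) (m + m').
Proof.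
apply: endappP => u; apply/funext => n.
by rewrite endappM !sandwichE addrA !mulrA.
Qed.

Lemma sandwichZl k x y m : sandwich (k *: x) y m = k *: sandwich x y m.
Proof.
apply: endappP => u; apply/funext => n.
by rewrite endappZ fctE !sandwichE -!scalerAl.
Qed.

Lemma sandwichZr k x y m : sandwich x (k *: y) m = k *: sandwich x y m.
Proof.
apply: endappP => u; apply/funext => n.
by rewrite endappZ fctE !sandwichE -!scalerAr.
Qed.

Lemma sandwichDl x x' y m : sandwich (x + x') y m = sandwich x y m + sandwich x' y m.
Proof.
apply: endappP => u; apply/funext => n.
by rewrite endappD fctE !sandwichE !mulrDl.
Qed.

Lemma sandwichDr x y y' m : sandwich x (y + y') m = sandwich x y m + sandwich x y' m.
Proof.
apply: endappP => u; apply/funext => n.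
by rewrite endappD fctE !sandwichE !mulrDr.
Qed.

Lemma sandwich0l y m : sandwich 0 y m = 0.
Proof. by have := sandwichZl 0 0 y m; rewrite !scale0r. Qed.

Lemma sandwich0r x m : sandwich x 0 m = 0.
Proof. by have := sandwichZr 0 x 0 m; rewrite !scale0r. Qed.

Lemma sandwichNl x y m : sandwich (- x) y m = - sandwich x y m.
Proof. by rewrite -!scaleN1r sandwichZl. Qed.

Lemma sandwichNr x y m : sandwich x (- y) m = - sandwich x y m.
Proof. by rewrite -!scaleN1r sandwichZr. Qed.

Lemma sandwichXl x n : sandwich x 1 0 ^+ n = sandwich (x ^+ n) 1 0.
Proof.
elim: n => [|n IHn]; first by rewrite !expr0 sandwich1.
by rewrite !exprS IHn sandwichM mulr1.
Qed.

Lemma sandwichXr y n : sandwich 1 y 0 ^+ n = sandwich 1 (y ^+ n) 0.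
Proof.
elim: n => [|n IHn]; first by rewrite !expr0 sandwich1.
by rewrite exprS IHn sandwichM mulr1 addr0 exprSr.
Qed.

End GradedEndomorphisms.

Section SerreSandwich.
Variables (I : eqType) (P : zmodType) (D : cartan_datum I P) (A : algType Qq).

Lemma serre_sandwichl (z : I -> A) i j :
  serre D (fun k => sandwich (z k) 1 0) i j = sandwich (serre D z i j) 1 0.
Proof.
rewrite /serre (big_morph (fun x => sandwich x 1 0) (id1 := 0) (op1 := +%R)
  (fun x y => sandwichDl x y 1 0) (sandwich0l 1 0)).
apply: eq_bigr => s _; rewrite /divpow !sandwichXl -!sandwichZl !sandwichM.
by rewrite !mulr1 !addr0 sandwichZl.
Qed.

(** Right multiplications compose in reverse order, and a Serre sum read backwards is the same sum
    up to this sign. *)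
Lemma serre_sandwichr (z : I -> A) i j :
  serre D (fun k => sandwich 1 (z k) 0) i j =
    (-1) ^+ `|1 - cartan D i j| *: sandwich 1 (serre D z i j) 0.
Proof.
rewrite -![serre _ _ _ _]/(serre_op _ _ _ _ _) serre_op_rev; congr (_ *: _).
rewrite /serre_op (big_morph (fun x => sandwich 1 x 0) (id1 := 0) (op1 := +%R)
  (fun x y => sandwichDr 1 x y 0) (sandwich0r 1 0)).
apply: eq_bigr => s _; rewrite /divpow !sandwichXr -!sandwichZr !sandwichM.
by rewrite !mulr1 !addr0 sandwichZr !mulrA.
Qed.

End SerreSandwich.

(** * Relations in U_q(g) and the graded adjoint representation *)

Section Relations.
Variables (I : eqType) (P : zmodType) (D : cartan_datum I P).

Local Notation alpha := (sroot D).
Local Notation hh := (scoroot D).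
Local Notation d := (half_norm D).
Local Notation e := (Ue D).
Local Notation f := (Uf D).
Local Notation K := (Uqh D).
Local Notation t := (Ut D).
Local Notation tinv := (Utinv D).
Local Notation b := (bform D).
Local Notation qi := (qi D).

Let pi_rel x y : Urel D x y ->
  quot_pi (Urel_proper (D := D)) x = quot_pi (Urel_proper (D := D)) y.
Proof. by move=> xy; apply/quot_piP; apply: gen_ideal_rel. Qed.

Lemma Uqh0 : K 0 = 1.
Proof. by rewrite /Uqh (pi_rel (Urel_q0 D)) rmorph1. Qed.

Lemma UqhD h k : K h * K k = K (h + k).
Proof. by rewrite /Uqh -(pi_rel (Urel_qD D h k)) rmorphM. Qed.

Lemma UqhC h k : K h * K k = K k * K h.
Proof. by rewrite !UqhD addrC. Qed.

Lemma UqhK h : K h * K (- h) = 1.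
Proof. by rewrite UqhD subrr Uqh0. Qed.

Lemma UqhVK h : K (- h) * K h = 1.
Proof. by rewrite UqhC UqhK. Qed.

Lemma Uqh_e h i : K h * e i = q ^ pairing h (alpha i) *: (e i * K h).
Proof.
have : K h * e i * K (- h) = q ^ pairing h (alpha i) *: e i.
  rewrite /Uqh /Ue -(linearZ_LR (quot_pi (Urel_proper (D := D)))).
  by rewrite -[RHS](pi_rel (Urel_qe D h i)) !rmorphM.
by move/(congr1 (fun x => x * K h)); rewrite -mulrA UqhVK mulr1 -scalerAl.
Qed.

Lemma Uqh_f h i : K h * f i = q ^ (- pairing h (alpha i)) *: (f i * K h).
Proof.
have : K h * f i * K (- h) = q ^ (- pairing h (alpha i)) *: f i.
  rewrite /Uqh /Uf -(linearZ_LR (quot_pi (Urel_proper (D := D)))).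
  by rewrite -[RHS](pi_rel (Urel_qf D h i)) !rmorphM.
by move/(congr1 (fun x => x * K h)); rewrite -mulrA UqhVK mulr1 -scalerAl.
Qed.

Lemma e_Uqh h i : e i * K h = q ^ (- pairing h (alpha i)) *: (K h * e i).
Proof. by rewrite Uqh_e scalerA -expfzDr ?q_neq0 // addNr scale1r. Qed.

Lemma f_Uqh h i : f i * K h = q ^ (pairing h (alpha i)) *: (K h * f i).
Proof. by rewrite Uqh_f scalerA -expfzDr ?q_neq0 // subrr scale1r. Qed.

Lemma pairing_t i j : pairing (hh i *+ d i) (alpha j) = b i j.
Proof.
have pairingMn (h : dual P) n x : pairing (h *+ n) x = pairing h x *+ n.
  by elim: n => // n IHn; rewrite !mulrS -[LHS]/(pairing h x + pairing (h *+ n) x) IHn.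
by rewrite pairingMn pairing_sroot.
Qed.

Lemma pairing_tinv i j : pairing (- (hh i *+ d i)) (alpha j) = - b i j.
Proof. by rewrite -pairing_t. Qed.

Lemma t_e i j : t i * e j = q ^ b i j *: (e j * t i).
Proof. by rewrite Uqh_e pairing_t. Qed.
Lemma t_f i j : t i * f j = q ^ (- b i j) *: (f j * t i).
Proof. by rewrite Uqh_f pairing_t. Qed.
Lemma e_t i j : e j * t i = q ^ (- b i j) *: (t i * e j).
Proof. by rewrite e_Uqh pairing_t. Qed.
Lemma e_tinv i j : e j * tinv i = q ^ (b i j) *: (tinv i * e j).
Proof. by rewrite e_Uqh pairing_tinv opprK. Qed.
Lemma f_tinv i j : f j * tinv i = q ^ (- b i j) *: (tinv i * f j).
Proof. by rewrite f_Uqh pairing_tinv. Qed.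

Lemma tK i : t i * tinv i = 1. Proof. exact: UqhK. Qed.
Lemma tVK i : tinv i * t i = 1. Proof. exact: UqhVK. Qed.

Lemma Uef i j : e i * f j - f j * e i =
  if i == j then (qi i - (qi i)^-1)^-1 *: (t i - tinv i) else 0.
Proof.
have := pi_rel (Urel_ef D i j); rewrite rmorphB !rmorphM => ->.
case: eqP => _; last exact: rmorph0.
rewrite [LHS](linearZ_LR (quot_pi (Urel_proper (D := D)))).
by congr (_ *: _); apply: rmorphB.
Qed.

Lemma serre_e i j : i != j -> serre D e i j = 0.
Proof.
move=> ij; have := pi_rel (Urel_serre_e D ij).
by rewrite serre_morph rmorph0.
Qed.

Lemma serre_f i j : i != j -> serre D f i j = 0.
Proof.
move=> ij; have := pi_rel (Urel_serre_f D ij).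
by rewrite serre_morph rmorph0.
Qed.

Lemma conj_e h i : K h * e i * K (- h) = q ^ pairing h (alpha i) *: e i.
Proof. by rewrite Uqh_e -scalerAl -mulrA UqhK mulr1. Qed.

Lemma conj_f h i : K h * f i * K (- h) = q ^ (- pairing h (alpha i)) *: f i.
Proof. by rewrite Uqh_f -scalerAl -mulrA UqhK mulr1. Qed.

Lemma conjM h x y : K h * (x * y) * K (- h) = (K h * x * K (- h)) * (K h * y * K (- h)).
Proof. by rewrite !mulrA -[_ * K (- h) * K h]mulrA UqhVK mulr1. Qed.

Lemma conj_K h k : K h * K k * K (- h) = K k.
Proof. by rewrite UqhC -mulrA UqhK mulr1. Qed.

Variable deg : I -> int.

(** The right entries are antipodes of the second tensor factors: S(e) = - e t, S(f) = - t^-1 f,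
    S(q^h) = q^-h. *)
Let E k := sandwich (e k) (t k) 0 - sandwich 1 (e k * t k) (- deg k).
Let F k := sandwich (f k) 1 0 - sandwich (t k) (tinv k * f k) (deg k).
Let Q h := sandwich (K h) (K (- h)) 0.

Let Q0 : Q 0 = 1.
Proof. by rewrite /Q oppr0 Uqh0 sandwich1. Qed.

Let QD h k : Q h * Q k = Q (h + k).
Proof. by rewrite /Q sandwichM !UqhD addr0 [in RHS]opprD [- h - k]addrC. Qed.

Let sandwich_conj h x y m : Q h * sandwich x y m * Q (- h) =
  sandwich (K h * x * K (- h)) (K h * y * K (- h)) m.
Proof. by rewrite /Q !sandwichM opprK add0r addr0 !mulrA. Qed.

Let QE h i : Q h * E i * Q (- h) = q ^ pairing h (alpha i) *: E i.
Proof.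
rewrite mulrBr mulrBl !sandwich_conj conjM conj_e !conj_K mulr1 UqhK.
by rewrite -scalerAl sandwichZl sandwichZr scalerBr.
Qed.

Let QF h i : Q h * F i * Q (- h) = q ^ (- pairing h (alpha i)) *: F i.
Proof.
rewrite mulrBr mulrBl !sandwich_conj conjM conj_f !conj_K mulr1 UqhK.
by rewrite -scalerAr sandwichZl sandwichZr scalerBr.
Qed.

(** The mixed terms cancel. What remains is a commutator of e_i and f_j in one entry at a time; the
    second one is shifted by deg j - deg i, which is 0 in the only case i = j where it survives.
    Hence [deg] can be arbitrary. *)
Let EF i j : E i * F j - F j * E i = if i == j then
  (qi i - (qi i)^-1)^-1 *: (Q (hh i *+ d i) - Q (- (hh i *+ d i))) else 0.
Proof.
rewrite /E /F !mulrBl !mulrBr !sandwichM !mulr1 !mul1r !add0r !addr0.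
(* Moving t_j past e_i and t_i past f_j produces inverse powers of q, by symmetry of the form. *)
have -> : sandwich (t j * e i) (t i * (tinv j * f j)) (deg j)
   = sandwich (e i * t j) (tinv j * f j * t i) (deg j).
  rewrite t_e mulrA [t i * tinv j]UqhC -mulrA t_f -scalerAr sandwichZr sandwichZl.
  by rewrite scalerA bform_sym -expfzDr ?q_neq0 // (subrr, addNr) scale1r mulrA.
have zmod_cancel (V : zmodType) (x1 x2 x3 x4 y1 y4 : V) :
    x1 + x4 + (- x2 - x3) - (y1 - x2 - (x3 - y4)) = (x1 - y1) + (x4 - y4).
  by rewrite !opprB (AC ((2*2)*(2*2)) ((1*8)*(2*6)*((3*7)*(4*5)))) /= !addNr !addr0.
rewrite opprB addrACA [- sandwich (e i * t j) _ _ - _]addrC zmod_cancel.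
have -> : e i * t i * (tinv j * f j) = tinv j * (e i * f j) * t i.
  rewrite -mulrA [t i * _]mulrA [t i * tinv j]UqhC -mulrA t_f -!scalerAr.
  rewrite mulrA e_tinv -scalerAl scalerA -!mulrA bform_sym -expfzDr ?q_neq0 //.
  by rewrite addNr scale1r.
rewrite [tinv j * f j * _]mulrA -[tinv j * f j * e i]mulrA [- deg i + _]addrC.
rewrite -[- sandwich (f j * e i) _ _]sandwichNl -[- sandwich (t j) _ _]sandwichNr.
rewrite -sandwichDl -sandwichDr -mulrBl -mulrBr.
rewrite -[f j * e i - _]opprB Uef; case: eqP => [->|_]; last first.
  by rewrite oppr0 mulr0 mul0r sandwich0l sandwich0r addr0.
rewrite subrr -scalerN -scalerAr -scalerAl sandwichZl sandwichZr -scalerDr.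
(* The entries (t - t^-1) # t and t # (t^-1 - t) add up to t # t^-1 - t^-1 # t. *)
congr (_ *: _); rewrite opprB mulrBr mulrBl tVK mul1r -mulrA tVK mulr1.
rewrite sandwichDl sandwichDr sandwichNl sandwichNr /Q opprK.
by rewrite addrC addrA subrK.
Qed.

(** The two terms of [E] q-commute, so [serre_add] treats them separately; in each, [serre_twist]
    splits off the torus factor. *)
Let serreE i j : i != j -> serre D E i j = 0.
Proof.
move=> ij; have -> : E = fun k =>
    - sandwich 1 (e k * t k) (- deg k) + sandwich (e k) (t k) 0.
  by apply/funext => k; rewrite addrC.
apply: serre_add => // [k l||].
- rewrite mulrN mulNr scalerN !sandwichM !mulr1 !mul1r !add0r !addr0.
  rewrite mulrA t_e -scalerAl sandwichZr scalerA -expfzDr ?q_neq0 // addNr scale1r.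
  by rewrite -!mulrA [t l * t k]UqhC.
(* Right entries multiply in reverse order, giving t_k e_k; the power of q restores e_k t_k. *)
- have -> : (fun k => - sandwich 1 (e k * t k) (- deg k)) = fun k =>
      sandwich 1 (e k) 0 * (- (q ^ (- b k k)) *: sandwich 1 (t k) (- deg k)).
    apply/funext => k; rewrite -scalerAr sandwichM mulr1 add0r.
    by rewrite e_t sandwichZr scaleNr.
  apply: (serre_twist (r := fun k l => q ^ (- b k l))) => // [k l|k l||].
  + rewrite -scalerAl -scalerAr !sandwichM !mulr1 addr0 add0r e_t sandwichZr.
    by rewrite !scalerA mulrC.
  + rewrite -!scalerAl -!scalerAr !sandwichM !mulr1 [t l * t k]UqhC addrC.
    by rewrite !scalerA mulrC.
  + by rewrite bform_sym.
  + by rewrite serre_sandwichr serre_e // sandwich0r scaler0.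
- have -> : (fun k => sandwich (e k) (t k) 0) = fun k =>
      sandwich (e k) 1 0 * sandwich 1 (t k) 0.
    by apply/funext => k; rewrite sandwichM !mulr1.
  apply: (serre_twist (r := fun _ _ => 1)) => // [k l|k l|].
  + by rewrite scale1r !sandwichM !mulr1 !mul1r.
  + by rewrite !sandwichM [t l * t k]UqhC.
  + by rewrite serre_sandwichl serre_e // sandwich0l.
Qed.

Let serreF i j : i != j -> serre D F i j = 0.
Proof.
move=> ij; apply: serre_add => // [k l||].
- rewrite mulrN mulNr scalerN !sandwichM !mulr1 !mul1r add0r addr0.
  by rewrite t_f sandwichZl.
- by rewrite serre_sandwichl serre_f // sandwich0l.
- have -> : (fun k => - sandwich (t k) (tinv k * f k) (deg k)) = fun k =>
      sandwich 1 (f k) 0 * - sandwich (t k) (tinv k) (deg k).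
    by apply/funext => k; rewrite mulrN sandwichM mul1r add0r.
  apply: (serre_twist (r := fun k l => q ^ (- b k l))) => // [k l|k l||].
  + rewrite mulNr mulrN !sandwichM mulr1 mul1r addr0 add0r f_tinv sandwichZr.
    by rewrite scalerN.
  + by rewrite !mulNr !mulrN !sandwichM [t k * t l]UqhC [tinv l * _]UqhC addrC.
  + by rewrite bform_sym.
  + by rewrite serre_sandwichr serre_f // sandwich0r scaler0.
Qed.

Lemma graded_ad_exists : exists rho : {lrmorphism Uq D -> graded_end (Uq D)},
  [/\ forall i, rho (e i) =
        sandwich (e i) (t i) 0 - sandwich 1 (e i * t i) (- deg i),
      forall i, rho (f i) =
        sandwich (f i) 1 0 - sandwich (t i) (tinv i * f i) (deg i)
    & forall h, rho (K h) = sandwich (K h) (K (- h)) 0].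
Proof. exact: (Uq_lift Q0 QD QE QF EF serreE serreF). Qed.

End Relations.

(** * Induction on generators, and the anti-automorphism [star] *)

Lemma free_algP (K : fieldType) (G : choiceType) (x : free_alg K G) :
  gen_subalg (fun y => exists g, y = free_gen K g) x.
Proof.
set S := fun _ => _.
have SZ c (y : free_alg K G) : gen_subalg S y -> gen_subalg S (c *: y).
  by move=> Sy; rewrite -mulr_algl; apply: gen_subalgM Sy; apply: gen_subalg_const.
have monom (s : seq G) : gen_subalg S (<< FMonom s >> : {malg K[{fmonom G}]}).
  elim: s => [|g s IHs].
    have := gen_subalg_const S 1; rewrite scale1r.
    rewrite -[1]/(@free_one K G) free_oneE.
    by rewrite -[1]/(<< fmone G >> : {malg K[{fmonom G}]}) fmoneE.
  have -> : << FMonom (g :: s) >>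
      = free_mul (free_gen K g) << FMonom s >> :> {malg K[{fmonom G}]}.
    rewrite free_mulE free_genE malgM_def fgmulUU mulr1.
    by rewrite -[mmul _ _]/(fmmul _ _) fmuE fmmulE.
  by apply: gen_subalgM IHs; apply: gen_subalg_gen; exists g.
rewrite [x]monalgE.
elim/big_rec: _ => [|m y _ Sy].
  have := gen_subalg_const S 0; rewrite scale0r.
  by rewrite -[0]/(@free_zero K G) free_zeroE.
rewrite -free_addE; apply: gen_subalgD Sy.
have -> : << x@_m *g m >> = free_scale x@_m (<< m >> : {malg K[{fmonom G}]}).
  by rewrite free_scaleE; apply/malgP => k; rewrite mcoeffZ !mcoeffU mulrnAr mulr1.
by apply: SZ; case: m.
Qed.

Section Star.
Variables (I : eqType) (P : zmodType) (D : cartan_datum I P).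

Local Notation alpha := (sroot D).
Local Notation hh := (scoroot D).
Local Notation d := (half_norm D).
Local Notation e := (Ue D).
Local Notation f := (Uf D).
Local Notation K := (Uqh D).
Local Notation t := (Ut D).
Local Notation tinv := (Utinv D).
Local Notation b := (bform D).
Local Notation qi := (qi D).

Inductive Uq_gen : Uq D -> Prop :=
| Uq_gen_e i : Uq_gen (e i)
| Uq_gen_f i : Uq_gen (f i)
| Uq_gen_q h : Uq_gen (K h).

Lemma Uq_genP x : gen_subalg Uq_gen x.
Proof.
rewrite -(quot_reprK x); elim: (free_algP (repr x)) =>
  [_ [[i|i|h] ->]|k|y z _ Sy _ Sz|y z _ Sy _ Sz].
- by apply: gen_subalg_gen; apply: Uq_gen_e.
- by apply: gen_subalg_gen; apply: Uq_gen_f.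
- by apply: gen_subalg_gen; apply: Uq_gen_q.
- rewrite (linearZ_LR (quot_pi (Urel_proper (D := D)))) rmorph1.
  exact: gen_subalg_const.
- by rewrite rmorphD; apply: gen_subalgD.
- by rewrite rmorphM; apply: gen_subalgM.
Qed.

(** Right multiplication reverses products, so a morphism to right multiplications stands in for one
    to the opposite algebra. *)
Let E k : graded_end (Uq D) := sandwich 1 (e k) 0.
Let F k : graded_end (Uq D) := sandwich 1 (f k) 0.
Let Q h : graded_end (Uq D) := sandwich 1 (K (- h)) 0.

Let star_exists : exists rho : {lrmorphism Uq D -> graded_end (Uq D)},
  [/\ forall i, rho (e i) = E i, forall i, rho (f i) = F i
    & forall h, rho (K h) = Q h].
Proof.
apply: Uq_lift; rewrite /E /F /Q.
- by rewrite oppr0 Uqh0 sandwich1.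
- by move=> h k; rewrite sandwichM UqhD mulr1 addr0 opprD addrC.
- move=> h i; rewrite !sandwichM opprK !mulr1 !addr0 mulrA Uqh_e -scalerAl.
  by rewrite -mulrA UqhK mulr1 sandwichZr.
- move=> h i; rewrite !sandwichM opprK !mulr1 !addr0 mulrA Uqh_f -scalerAl.
  by rewrite -mulrA UqhK mulr1 sandwichZr.
- move=> i j; rewrite !sandwichM !mulr1 !addr0 -sandwichNr -sandwichDr.
  rewrite -opprB Uef opprK; case: eqP => _; last by rewrite oppr0 sandwich0r.
  by rewrite -scalerN sandwichZr opprB sandwichDr sandwichNr.
- by move=> i j ij; rewrite serre_sandwichr serre_e // sandwich0r scaler0.
- by move=> i j ij; rewrite serre_sandwichr serre_f // sandwich0r scaler0.
Qed.

Let rho := sval (cid star_exists).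

(* The anti-automorphism fixing e_i and f_i and sending q^h to q^-h; [rho x] is
   right multiplication by [star x]. *)
Definition star (x : Uq D) : Uq D := endapp (rho x) (fun=> 1) 0.

Let rho_star x : rho x = sandwich 1 (star x) 0.
Proof.
have [rhoe rhof rhoq] := svalP (cid star_exists).
have starE y z : rho y = sandwich 1 z 0 -> rho y = sandwich 1 (star y) 0.
  by move=> yz; rewrite /star yz sandwichE !mul1r.
elim: (Uq_genP x) => [_ [i|i|h]|k|y z _ IHy _ IHz|y z _ IHy _ IHz].
- exact: starE (rhoe i).
- exact: starE (rhof i).
- exact: starE (rhoq h).
- apply: (starE _ k%:A).
  by rewrite (linearZ_LR rho) rmorph1 sandwichZr sandwich1.
- by apply: (starE _ (star y + star z)); rewrite rmorphD /= IHy IHz sandwichDr.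
- apply: (starE _ (star z * star y)).
  by rewrite rmorphM /= IHy IHz sandwichM mulr1 addr0.
Qed.

Let star_eq x y : rho x = sandwich 1 y 0 -> star x = y.
Proof. by rewrite /star => ->; rewrite sandwichE !mul1r. Qed.

Lemma star_e i : star (e i) = e i.
Proof. by apply: star_eq; have [-> _ _] := svalP (cid star_exists). Qed.
Lemma star_f i : star (f i) = f i.
Proof. by apply: star_eq; have [_ -> _] := svalP (cid star_exists). Qed.
Lemma star_q h : star (K h) = K (- h).
Proof. by apply: star_eq; have [_ _ ->] := svalP (cid star_exists). Qed.
Lemma star1 : star 1 = 1.
Proof. by apply: star_eq; rewrite rmorph1 sandwich1. Qed.
Lemma starM x y : star (x * y) = star y * star x.
Proof. by apply: star_eq; rewrite rmorphM /= !rho_star sandwichM mulr1 addr0. Qed.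

Lemma star_is_linear : linear star.
Proof.
move=> k x y; apply: star_eq.
by rewrite linearP /= !rho_star sandwichDr sandwichZr.
Qed.

HB.instance Definition _ :=
  GRing.isLinear.Build Qq (Uq D) (Uq D) *:%R star star_is_linear.

Lemma starZ k x : star (k *: x) = k *: star x.
Proof. exact: (linearZ_LR star). Qed.

Lemma starD x y : star (x + y) = star x + star y.
Proof. exact: (raddfD star). Qed.

Lemma starB x y : star (x - y) = star x - star y.
Proof. exact: (raddfB star). Qed.

Lemma starK : involutive star.
Proof.
move=> x; elim: (Uq_genP x) => [_ [i|i|h]|k|y z _ IHy _ IHz|y z _ IHy _ IHz].
- by rewrite !star_e.
- by rewrite !star_f.
- by rewrite !star_q opprK.
- by rewrite !starZ !star1.
- by rewrite !starD IHy IHz.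
- by rewrite !starM IHy IHz.
Qed.

Lemma star_parabolic i x :
  x \in subalg (parabolic_gen i) -> star x \in subalg (parabolic_gen (D := D) i).
Proof.
move/subalgP; elim=> [_ [|j|h]|k|y z _ IHy _ IHz|y z _ IHy _ IHz].
- by rewrite star_e; apply/mem_subalg/parabolic_e.
- by rewrite star_f; apply/mem_subalg/parabolic_f.
- by rewrite star_q; apply/mem_subalg/parabolic_q.
- have -> : star k%:A = k%:A.
    by rewrite -[RHS](congr1 (fun x => k *: x) star1); exact: starZ.
  by rewrite rpredZ // rpred1.
- by have -> : star (y + z) = star y + star z; [exact: starD | rewrite rpredD].
- by have -> : star (y * z) = star z * star y; [exact: starM | rewrite rpredM].
Qed.

End Star.

Lemma oppM_neq0 (F : fieldType) (x y : F) : x != 0 -> y != 0 -> - (x * y) != 0.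
Proof. by move=> x0 y0; rewrite oppr_eq0 mulf_neq0. Qed.

(** * The left action, and polynomials in e_i t_i *)

Section GradedAdjoint.
Variables (I : eqType) (P : zmodType) (D : cartan_datum I P).

Local Notation alpha := (sroot D).
Local Notation hh := (scoroot D).
Local Notation d := (half_norm D).
Local Notation e := (Ue D).
Local Notation f := (Uf D).
Local Notation K := (Uqh D).
Local Notation t := (Ut D).
Local Notation tinv := (Utinv D).
Local Notation b := (bform D).
Local Notation qi := (qi D).
Local Notation U := (Uq D).

(* The adjoint action x . u = sum x_(1) u S(x_(2)) in which [deg] grades the
   factor x_(2): e_i |-> e_i # t_i^-1 + z^deg 1 # e_i and
   f_i |-> f_i # 1 + z^-deg t_i # f_i, with z the shift of int -> U_q(g). *)
Definition graded_ad (deg : I -> int) : {lrmorphism U -> graded_end U} :=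
  sval (cid (graded_ad_exists D deg)).

Section Degree.
Variable deg : I -> int.
Implicit Types (x u : U) (v : int -> U) (n k : int).

Local Notation gad x := (endapp (graded_ad deg x)).

Lemma graded_ad_e i v n :
  gad (e i) v n = e i * v n * t i - v (n - deg i) * e i * t i.
Proof.
rewrite /graded_ad; have [-> _ _] := svalP (cid (graded_ad_exists D deg)).
by rewrite endappBE !sandwichE addr0 mul1r mulrA.
Qed.

Lemma graded_ad_f i v n :
  gad (f i) v n = f i * v n - t i * v (n + deg i) * tinv i * f i.
Proof.
rewrite /graded_ad; have [_ -> _] := svalP (cid (graded_ad_exists D deg)).
by rewrite endappBE !sandwichE addr0 mulr1 mulrA.
Qed.

Lemma graded_ad_q h v n : gad (K h) v n = K h * v n * K (- h).
Proof.
rewrite /graded_ad; have [_ _ ->] := svalP (cid (graded_ad_exists D deg)).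
by rewrite sandwichE addr0.
Qed.

Lemma graded_ad_const (c : Qq) v : gad c%:A v = c *: v.
Proof. by rewrite (linearZ_LR (graded_ad deg)) rmorph1. Qed.

Lemma graded_adD x y v : gad (x + y) v = gad x v + gad y v.
Proof. by rewrite rmorphD. Qed.

Lemma graded_adM x y v : gad (x * y) v = gad x (gad y v).
Proof. by rewrite rmorphM. Qed.

Definition supp_le k v := forall n, k < n -> v n = 0.

Definition bump0 u n : U := if n == 0 then u else 0.

Lemma supp_bump0 u : supp_le 0 (bump0 u).
Proof. by move=> n n_gt0; rewrite /bump0 gt_eqF. Qed.

Lemma bump0_is_linear : linear bump0.
Proof.
move=> k u v; apply/funext => n; rewrite /bump0 !fctE /=.
by case: eqP => // _; rewrite scaler0 addr0.
Qed.

End Degree.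

Section Parabolic.
Variable i : I.

Let deg (j : I) : int := (j != i)%:Z.
Let gad x := endapp (graded_ad deg x).

Definition lact (x u : U) : U := gad x (bump0 u) 0.

(** Here e_i and f_i have degree 0 and the other f_j only shift downwards; an e_j with j <> i would
    shift upwards. *)
Let parabolic_supp x : x \in subalg (parabolic_gen (D := D) i) ->
  forall k v, supp_le k v -> supp_le k (gad x v).
Proof.
rewrite /gad => /subalgP; elim=> [_ [|j|h]|c|y z _ IHy _ IHz|y z _ IHy _ IHz] k v vk n kn.
- by rewrite graded_ad_e /deg eqxx subr0 vk // mulr0 !mul0r subrr.
- rewrite graded_ad_f !vk ?mulr0 ?mul0r ?subrr //.
  by rewrite (lt_le_trans kn) // lerDl.
- by rewrite graded_ad_q vk // mulr0 mul0r.
- by rewrite [endapp _ v]graded_ad_const fctE vk ?scaler0.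
- by rewrite [endapp _ v]graded_adD fctE (IHy _ _ vk) // (IHz _ _ vk) // addr0.
- by rewrite [endapp _ v]graded_adM (IHy k) //; apply: IHz.
Qed.

Lemma lact_linearr x : linear (lact x).
Proof.
move=> k u v; rewrite /lact /gad bump0_is_linear.
by rewrite (endapp_linear (graded_ad deg x)).
Qed.

Lemma lact_linearl u : linear (lact^~ u).
Proof. by move=> k x y; rewrite /lact /gad linearP. Qed.

Lemma lactBl x y u : lact (x - y) u = lact x u - lact y u.
Proof. by rewrite /lact /gad rmorphB. Qed.

Lemma lactZl (c : Qq) x u : lact (c *: x) u = c *: lact x u.
Proof. by rewrite /lact /gad (linearZ_LR (graded_ad deg)). Qed.

Lemma lact1 u : lact 1 u = u.
Proof. by rewrite /lact /gad rmorph1 endapp1. Qed.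

(* Parabolic elements do not raise the degree, so that the degree-zero component
   of the result depends on that of the argument only. *)
Lemma lactM x y u : x \in subalg (parabolic_gen (D := D) i) ->
  y \in subalg (parabolic_gen (D := D) i) -> lact (x * y) u = lact x (lact y u).
Proof.
move=> px py; rewrite /lact [gad (x * y)]/gad graded_adM; set v := endapp _ (bump0 u).
have := parabolic_supp py (supp_bump0 u). rewrite /gad -/v => v0.
have v1 : supp_le (-1) (v - bump0 (v 0)).
  move=> n n_gt; have [->|n_neq0] := eqVneq n 0.
    by rewrite !fctE /bump0 eqxx subrr.
  by rewrite !fctE /bump0 (negPf n_neq0) subr0 v0 //; lia.
apply/eqP; rewrite -subr_eq0; apply/eqP.
have := parabolic_supp px v1 (n := 0) isT.
by rewrite {1}/gad -scaleN1r addrC endapp_linear scaleN1r addrC.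
Qed.

Lemma lact_e u : lact (e i) u = ad_e i u.
Proof. by rewrite /lact /gad graded_ad_e /deg eqxx subr0 /bump0 eqxx. Qed.

Lemma lact_fi u : lact (f i) u = ad_f i u.
Proof. by rewrite /lact /gad graded_ad_f /deg eqxx addr0 /bump0 eqxx. Qed.

(** The term t_j u t_j^-1 f_j lands in degree -1; this is how f_j gets killed in the second
    factor. *)
Lemma lact_f j u : j != i -> lact (f j) u = f j * u.
Proof.
move=> ji; rewrite /lact /gad graded_ad_f /deg ji /bump0 eqxx add0r.
by rewrite mulr0 !mul0r subr0.
Qed.

Lemma lact_q h u : lact (K h) u = K h * u * K (- h).
Proof. by rewrite /lact /gad graded_ad_q /bump0 eqxx. Qed.

End Parabolic.

Section Independence.
Variable i : I.

Let gad x := endapp (graded_ad (fun _ => 1) x : graded_end U).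

Local Notation Uminus := (subalg (minus_gen (D := D))).

(** In the height grading t_j # f_j lowers the degree, so only the left multiplication f_j # 1
    contributes to the top. *)
Let minus_top y : y \in Uminus -> forall k v, supp_le k v ->
  supp_le k (gad y v) /\ gad y v k = y * v k.
Proof.
rewrite /gad => /subalgP; elim=> [_ [j]|c|y1 y2 _ IH1 _ IH2|y1 y2 _ IH1 _ IH2] k v vk.
- split=> [n kn|]; rewrite graded_ad_f.
    by rewrite !vk ?mulr0 ?mul0r ?subrr //; lia.
  by rewrite [v (k + 1)]vk ?mulr0 ?mul0r ?subr0 //; lia.
- rewrite [endapp _ v]graded_ad_const; split=> [n kn|]; rewrite fctE.
    by rewrite vk ?scaler0.
  by rewrite mulr_algl.
- have [s1 e1] := IH1 _ _ vk; have [s2 e2] := IH2 _ _ vk.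
  rewrite [endapp _ v]graded_adD; split=> [n kn|]; rewrite fctE.
    by rewrite s1 ?s2 ?addr0.
  by rewrite e1 e2 mulrDl.
- have [s2 e2] := IH2 _ _ vk; have [s1 e1] := IH1 _ _ s2.
  by rewrite [endapp _ v]graded_adM; split=> //; rewrite e1 e2 mulrA.
Qed.

Local Notation et := (e i * t i).

(** In contrast with U_q^-, the term 1 # e_i raises the degree by one; this tells the powers of e_i
    t_i apart. *)
Let et_top k v : supp_le k v ->
  supp_le (k + 1) (gad et v) /\ gad et v (k + 1) = - (t i * v k * tinv i * et).
Proof.
move=> vk; have gadE n : gad et v n = et * v n - t i * v (n - 1) * tinv i * et.
  rewrite /gad graded_adM graded_ad_e !graded_ad_q -/(tinv i) !mulrA; congr (_ - _).
  by rewrite -!mulrA tVK mulr1.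
split=> [n kn|]; rewrite gadE.
  by rewrite !vk ?mulr0 ?mul0r ?subrr //; lia.
by rewrite vk ?addrK ?mulr0 ?sub0r //; lia.
Qed.

Lemma t_etX n : t i * et ^+ n = (q ^ b i i) ^+ n *: (et ^+ n * t i).
Proof.
elim: n => [|n IHn]; first by rewrite !expr0 mulr1 mul1r scale1r.
have t_et : t i * et = q ^ b i i *: (et * t i) by rewrite mulrA t_e -scalerAl.
rewrite exprS mulrA t_et -scalerAl -[et * t i * _]mulrA IHn -scalerAr scalerA.
by rewrite exprS mulrA.
Qed.

Let etX_top n : exists2 c : Qq, c != 0 &
  supp_le n%:Z (gad (et ^+ n) (bump0 1)) /\
  gad (et ^+ n) (bump0 1) n%:Z = c *: et ^+ n.
Proof.
elim: n => [|n [c c_neq0 [sn en]]].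
  exists 1; first exact: oner_neq0.
  by rewrite /gad !expr0 rmorph1 endapp1 scale1r; split=> //; apply: supp_bump0.
have [sn1 en1] := et_top sn.
have [r r_neq0 t_etn] : exists2 r : Qq, r != 0 &
    t i * et ^+ n = r *: (et ^+ n * t i).
  exists ((q ^ b i i) ^+ n); last exact: t_etX.
  by apply/expf_neq0/expfz_neq0/q_neq0.
exists (- (c * r)).
  exact: oppM_neq0.
have -> : Posz n.+1 = n%:Z + 1 by lia.
rewrite exprS /gad graded_adM; split=> //.
rewrite [LHS]en1 en -scalerAr t_etn scalerA -!scalerAl scaleNr; congr (- (_ *: _)).
by rewrite -[_ * t i * tinv i]mulrA tK mulr1 -exprSr exprS.
Qed.

(* The top degree component of the action on 1 is a nonzero multiple of the
   leading term of [p], which therefore vanishes. *)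
Lemma horner_minus (p : {poly U}) : p \is a polyOver Uminus ->
  p.[et] \in Uminus -> p.[et] = p`_0.
Proof.
have [m] := ubnP (size p); elim: m p => // m IHm p lepm pU petU.
have [sz_p|sz_p] := leqP (size p) 1.
  by rewrite (size1_polyC sz_p) hornerC coefC eqxx.
have [N sz_pN] : exists N, size p = N.+2 by exists (size p).-2; lia.
pose top0 (x : U) := gad x (bump0 1) N.+1%:Z.
have top0D x y : top0 (x + y) = top0 x + top0 y by rewrite /top0 /gad graded_adD.
have top0_low k : (k < N.+1)%N -> top0 (p`_k * et ^+ k) = 0.
  move=> ltkN; have [_ _ [sk _]] := etX_top k.
  have [s1 _] := minus_top (polyOverP pU k) sk.
  rewrite /top0 /gad graded_adM; apply: s1; by rewrite ltz_nat.
have top0_lead : exists2 c : Qq, c != 0 &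
    top0 (p`_N.+1 * et ^+ N.+1) = c *: (p`_N.+1 * et ^+ N.+1).
  have [c c_neq0 [sN eN]] := etX_top N.+1; exists c => //.
  have [_ e1] := minus_top (polyOverP pU N.+1) sN.
  by rewrite /top0 /gad graded_adM [LHS]e1 eN -scalerAr.
(* As an element of U_q^-, [p.[et]] keeps 1 in degrees at most 0, while [top0] reads degree N +
   1. *)
have lead0 : p`_N.+1 * et ^+ N.+1 = 0.
  have [s0 _] := minus_top petU (@supp_bump0 1).
  have : top0 p.[et] = 0 by exact: s0.
  rewrite horner_coef sz_pN big_ord_recr /= top0D.
  have -> : top0 (\sum_(k < N.+1) p`_k * et ^+ k) = 0.
    elim/big_rec: _ => [|k x _ x0]; first by rewrite /top0 /gad rmorph0.
    by rewrite top0D x0 addr0 top0_low.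
  have [c c_neq0 ->] := top0_lead; rewrite add0r => /eqP.
  by rewrite scaler_eq0 (negPf c_neq0) => /eqP.
(* The leading term is known to vanish as a product, not its coefficient; hence a truncation of [p]
   with the same value. *)
pose p' := \poly_(k < N.+1) p`_k.
have pE : p.[et] = p'.[et].
  rewrite horner_coef sz_pN big_ord_recr /= lead0 addr0.
  rewrite (horner_coef_wide _ (size_poly _ _)).
  by apply: eq_bigr => k _; rewrite coef_poly ltn_ord.
rewrite pE IHm ?coef_poly // -?pE //.
  by rewrite (leq_ltn_trans (size_poly _ _)) // -ltnS -sz_pN.
apply/polyOverP => k; rewrite coef_poly; case: ifP => // _.
  exact: (polyOverP pU).
exact: rpred0.
Qed.

End Independence.

End GradedAdjoint.

(** * The sl2-string of f_j under ad_{f_i} and ad_{e_i} *)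

(** For a = v^n and m = v^M this is [n+1][M-n] = [n][M+1-n] + [M-2n]; the powers are made
    independent variables so that [field] applies. *)
Lemma sl2_weight_step (F : fieldType) (v m a : F) : v != 0 -> m != 0 -> a != 0 ->
  v - v^-1 != 0 ->
  (a * v - (a * v)^-1) * (m * v / (a * v) - (a * v) / (m * v)) / (v - v^-1) ^+ 2
  = (a - a^-1) * (m * v / a - a / (m * v)) / (v - v^-1) ^+ 2
    + (v - v^-1)^-1 * (m / a ^+ 2 - a ^+ 2 / m).
Proof.
move=> v0 m0 a0 vv.
have v_sqr : v * v - 1 != 0.
  have -> : v * v - 1 = v * (v - v^-1) by rewrite mulrBr divff.
  by rewrite mulf_neq0.
by field; rewrite v0 m0 a0 v_sqr.
Qed.

Lemma expr_div_sqr (F : fieldType) (v : F) m n :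
  v ^+ m * (v ^+ 2)^-1 ^+ n = v ^+ m / (v ^+ n) ^+ 2.
Proof. by rewrite exprVn -!exprM mulnC. Qed.

Lemma gauss_mulE (F : fieldType) (v a x : F) : a != 0 ->
  (a - a^-1) * (x * a / a - a / (x * a)) / (v - v^-1) ^+ 2
  = (a - a^-1) / (v - v^-1) * ((x - x^-1) / (v - v^-1)).
Proof.
move=> a0; have -> : a / (x * a) = x^-1 by rewrite invfM mulrCA divff ?mulr1.
by rewrite mulfK // mulrACA expr2 invfM.
Qed.

Lemma signr_exprV (F : fieldType) (v : F) m r : v != 0 ->
  (- v^-1 ^- m.+1) ^+ r * v^-1 ^+ (m * r) = (-1) ^+ r * v ^+ r.
Proof.
move=> v0; rewrite exprVn invrK [in LHS]exprNn -mulrA; congr (_ * _).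
by rewrite -exprM mulSn exprD exprVn -mulrA mulfV ?mulr1 // expf_neq0.
Qed.

Section AdjointString.
Variables (I : eqType) (P : zmodType) (D : cartan_datum I P) (i : I).

Local Notation alpha := (sroot D).
Local Notation hh := (scoroot D).
Local Notation d := (half_norm D).
Local Notation e := (Ue D).
Local Notation f := (Uf D).
Local Notation K := (Uqh D).
Local Notation t := (Ut D).
Local Notation tinv := (Utinv D).
Local Notation b := (bform D).
Local Notation qi := (qi D).
Local Notation U := (Uq D).
Local Notation adf := (@ad_f _ _ D i).
Local Notation ade := (@ad_e _ _ D i).
Local Notation Uminus := (subalg (minus_gen (D := D))).
Implicit Types (u v x y : U).

Lemma parabolic_mem_e : e i \in subalg (parabolic_gen (D := D) i).
Proof. exact/mem_subalg/parabolic_e. Qed.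
Lemma parabolic_mem_f j : f j \in subalg (parabolic_gen (D := D) i).
Proof. exact/mem_subalg/parabolic_f. Qed.
Lemma ad_fZ k u : adf (k *: u) = k *: adf u.
Proof. by rewrite /ad_f -!(scalerAl, scalerAr) scalerBr. Qed.

Lemma ad_fD u v : adf (u + v) = adf u + adf v.
Proof. by rewrite /ad_f !(mulrDl, mulrDr) opprD addrACA. Qed.

Lemma ad_f0 : adf 0 = 0.
Proof. by rewrite /ad_f !(mulr0, mul0r) subrr. Qed.

Lemma ad_f1 : adf 1 = 0.
Proof. by rewrite /ad_f !mulr1 tK mul1r subrr. Qed.

Lemma ad_fM u v : adf (u * v) = adf u * v + t i * u * tinv i * adf v.
Proof.
rewrite /ad_f mulrBl mulrBr !mulrA addrA subrK; congr (_ - _ * _ * _).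
by rewrite -[_ * tinv i * t i]mulrA tVK mulr1.
Qed.

Lemma ad_eZ k u : ade (k *: u) = k *: ade u.
Proof. by rewrite /ad_e -!(scalerAl, scalerAr) scalerBr. Qed.

Lemma ad_eD u v : ade (u + v) = ade u + ade v.
Proof. by rewrite /ad_e !(mulrDl, mulrDr) opprD addrACA. Qed.

Lemma ad_e1 : ade 1 = 0.
Proof. by rewrite /ad_e mulr1 mul1r subrr. Qed.

Lemma ad_eM u v : ade (u * v) = ade u * (tinv i * v * t i) + u * ade v.
Proof.
rewrite /ad_e mulrBl mulrBr !mulrA -![_ * t i * tinv i]mulrA tK !mulr1.
by rewrite addrA subrK.
Qed.

Lemma ad_e_f j : j != i -> ade (f j) = 0.
Proof.
by move=> ji; rewrite /ad_e -mulrBl Uef eq_sym (negPf ji) mul0r.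
Qed.

(** Since [lact] is multiplicative on U_q(p_i), the relation for [e_i, f_i] passes to the
    operators. *)
Lemma ad_sl2 u : ade (adf u) = adf (ade u) +
  (qi i - (qi i)^-1)^-1 *: (t i * u * tinv i - tinv i * u * t i).
Proof.
have e_p := parabolic_mem_e; have f_p := parabolic_mem_f i.
have := congr1 (fun x => lact i x u) (Uef D i i).
rewrite eqxx lactBl lactZl lactBl !lactM // !lact_e !lact_fi !lact_q opprK => <-.
by rewrite addrC subrK.
Qed.

Lemma ad_f_conj h u : K h * adf u * K (- h) =
  q ^ (- pairing h (alpha i)) *: adf (K h * u * K (- h)).
Proof.
rewrite /ad_f /Ut /Utinv mulrBr mulrBl ![in LHS]conjM conj_f !conj_K.
by rewrite -!(scalerAl, scalerAr) scalerBr.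
Qed.

Variable j : I.
Hypothesis ji : j != i.

Local Notation M := (`|cartan D i j|%N).

Definition root_string (n : nat) : U := iter n adf (f j).
Local Notation X := root_string.

Lemma conj_string h n : K h * X n * K (- h) =
  (q ^ (- pairing h (alpha j)) * (q ^ (- pairing h (alpha i))) ^+ n) *: X n.
Proof.
elim: n => [|n IHn]; first by rewrite conj_f expr0 mulr1.
rewrite ad_f_conj IHn ad_fZ scalerA; congr (_ *: _).
by rewrite exprS mulrCA.
Qed.

Local Notation kappa n := (q ^ (- b i j) * (q ^ (- b i i)) ^+ n).

Lemma t_string n : t i * X n * tinv i = kappa n *: X n.
Proof. by rewrite conj_string !pairing_t. Qed.

Lemma tinv_string n : tinv i * X n * t i = (kappa n)^-1 *: X n.
Proof.
have := conj_string (- (hh i *+ d i)) n; rewrite opprK !pairing_tinv opprK => ->.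
by congr (_ *: _); rewrite invfM -exprVn !invr_expz !opprK.
Qed.

Lemma string_iter_qcomm n : X n = iter_qcomm (f i) (fun k => kappa k) (f j) n.
Proof.
elim: n => //= n <-; rewrite /ad_f; congr (_ - _).
by rewrite -[LHS]/(t i * X n * tinv i * f i) t_string -scalerAl.
Qed.

(** At n = M + 1 the string, as an iterated q-commutator, is a multiple of the Serre sum. *)
Lemma string_high n : (M < n)%N -> X n = 0.
Proof.
move=> ltMn; rewrite -(subnK ltMn); elim: (n - M.+1)%N => [|k IHk].
  rewrite add0n string_iter_qcomm -(@cartan_abs1 _ _ D i j) 1?eq_sym //.
  have := @serre_op_eq0 _ _ D U i j (f i) (f j) true.
  rewrite eq_sym ji expr1 !mulN1r => /(_ isT) [+ _]; apply.
  by apply: (@serre_f _ _ D i j); rewrite eq_sym.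
rewrite addSn -[LHS]/(adf (X (k + M.+1))) IHk.
exact: ad_f0.
Qed.

(* g n = [n]_i [M + 1 - n]_i *)
Let g n : Qq := (qi i ^+ n - (qi i ^+ n)^-1) *
  (qi i ^+ M * qi i / qi i ^+ n - qi i ^+ n / (qi i ^+ M * qi i))
  / (qi i - (qi i)^-1) ^+ 2.

Let kappaE n : kappa n - (kappa n)^-1 =
  qi i ^+ M / (qi i ^+ n) ^+ 2 - (qi i ^+ n) ^+ 2 / qi i ^+ M.
Proof.
have -> : kappa n = qi i ^+ M / (qi i ^+ n) ^+ 2.
  rewrite -!invr_expz q_bform_ii q_bform_neq 1?eq_sym // invrK.
  exact: expr_div_sqr.
by rewrite invf_div.
Qed.

(** [f j] is a highest weight vector of weight M: [ad_e] kills it and t_i acts by q_i^M. The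
    commutators [M-2n]_i then accumulate to [g]. *)
Let ad_e_string_g n : ade (X n.+1) = g n.+1 *: X n.
Proof.
have gS k : g k.+1 = g k + (qi i - (qi i)^-1)^-1 * (kappa k - (kappa k)^-1).
  rewrite kappaE /g [qi i ^+ k.+1]exprSr.
  apply: sl2_weight_step; last exact: qi_subV_neq0.
  - exact: qi_neq0.
  - exact/expf_neq0/qi_neq0.
  - exact/expf_neq0/qi_neq0.
have g0 : g 0 = 0 by rewrite /g expr0 invr1 subrr !mul0r.
elim: n => [|n IHn].
  rewrite -[X 1]/(adf (X 0)) ad_sl2 [ade _]ad_e_f // ad_f0 add0r.
  by rewrite t_string tinv_string -scalerBl scalerA gS g0 add0r.
rewrite -[X n.+2]/(adf (X n.+1)) ad_sl2 IHn ad_fZ -[adf (X n)]/(X n.+1).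
by rewrite t_string tinv_string -scalerBl scalerA -scalerDl [in RHS]gS.
Qed.

Lemma ad_e_string0 : ade (X 0) = 0.
Proof. exact: ad_e_f. Qed.

Let g_neq0 n : (n < M)%N -> g n.+1 != 0.
Proof.
move=> ltnM; have -> : g n.+1 = qint D i n.+1 * qint D i (M - n.+1).+1.
  rewrite /g -exprSr.
  have -> : qi i ^+ M.+1 = qi i ^+ (M - n.+1).+1 * qi i ^+ n.+1.
    by rewrite -exprD addSn subnK.
  by apply: gauss_mulE; apply/expf_neq0/qi_neq0.
by apply: mulf_neq0; apply: qint_neq0.
Qed.

Lemma ad_e_string n :
  exists2 c : Qq, ade (X n.+1) = c *: X n & (n < M)%N -> c != 0.
Proof. by exists (g n.+1); [exact: ad_e_string_g | exact: g_neq0]. Qed.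

(** In the q-binomial expansion with v = q_i^-1 and y = v^-(M+1), the coefficient (-y)^r v^(M r) is
    (-1)^r q_i^r, as in T_i(f_j). *)
Lemma braid_fj_string (T : braid_symmetry D i) :
  braid T (f j) = (qfact D i M)^-1 *: X M.
Proof.
pose v := (qi i)^-1.
have v_neq0 : v != 0 by rewrite invr_eq0 qi_neq0.
rewrite (braid_fj T ji) string_iter_qcomm.
have -> : (fun k => kappa k) = fun k => v ^- M.+1 * v ^+ (2 * k).+1.
  apply/funext => k; rewrite exprVS_odd //.
  rewrite -!invr_expz q_bform_ii q_bform_neq 1?eq_sym //.
  by rewrite /v !exprVn.
rewrite (iter_qcommE (v ^- M.+1) (@qint_neq0 _ _ D i) (@qintDV _ _ D i)).
rewrite scalerA mulVf ?qfact_neq0 // scale1r; apply: eq_bigr => r _.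
congr (_ *: _); exact/esym/signr_exprV/qi_neq0.
Qed.

End AdjointString.

(** * The algebra generated by the strings is U_i *)

Section KernelAlgebra.
Variables (I : eqType) (P : zmodType) (D : cartan_datum I P) (i : I).

Local Notation alpha := (sroot D).
Local Notation hh := (scoroot D).
Local Notation d := (half_norm D).
Local Notation e := (Ue D).
Local Notation f := (Uf D).
Local Notation K := (Uqh D).
Local Notation t := (Ut D).
Local Notation tinv := (Utinv D).
Local Notation U := (Uq D).
Local Notation adf := (@ad_f _ _ D i).
Local Notation ade := (@ad_e _ _ D i).
Local Notation Uminus := (subalg (minus_gen (D := D))).
Local Notation et := (e i * t i).
Implicit Types (u v x y : U).

Lemma conj_const h (c : Qq) : K h * c%:A * K (- h) = c%:A.
Proof. by rewrite -scalerAr -scalerAl mulr1 UqhK. Qed.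

Lemma conjD h x y : K h * (x + y) * K (- h) = K h * x * K (- h) + K h * y * K (- h).
Proof. by rewrite mulrDr mulrDl. Qed.

Lemma conj_minus h u : u \in Uminus -> K h * u * K (- h) \in Uminus.
Proof.
move/subalgP; elim=> [_ [j]|c|x y _ IHx _ IHy|x y _ IHx _ IHy].
- by rewrite conj_f rpredZ // mem_subalg.
- by rewrite [X in X \in _]conj_const rpredZ // rpred1.
- by rewrite [X in X \in _]conjD rpredD.
- by rewrite [X in X \in _]conjM rpredM.
Qed.

Lemma f_minus j : f j \in Uminus.
Proof. exact: mem_subalg. Qed.

Lemma ad_f_minus u : u \in Uminus -> adf u \in Uminus.
Proof.
move=> um; have cm := conj_minus (hh i *+ d i) um; have fm := f_minus i.
exact: (rpredB (rpredM fm um) (rpredM cm fm)).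
Qed.

Lemma ad_f_star_minus u : u \in Uminus -> ad_f_star i u \in Uminus.
Proof.
move=> um; have cm := conj_minus (hh i *+ d i) um; have fm := f_minus i.
have -> : ad_f_star i u = u * f i - f i * (t i * u * tinv i) by rewrite !mulrA.
exact: (rpredB (rpredM um fm) (rpredM fm cm)).
Qed.

Inductive string_gen : U -> Prop :=
| string_gen_intro j n : j != i -> string_gen (root_string D i j n).

Local Notation KA := (subalg string_gen).

Lemma string_mem j n : j != i -> root_string D i j n \in KA.
Proof. by move=> ji; apply: mem_subalg. Qed.

Lemma string_minus u : u \in KA -> u \in Uminus.
Proof.
move/subalgP; elim=> [_ [j n ji]|c|x y _ IHx _ IHy|x y _ IHx _ IHy].
- by elim: n => [|n IHn]; [exact: f_minus | exact: ad_f_minus].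
- by rewrite rpredZ // rpred1.
- exact: rpredD.
- exact: rpredM.
Qed.

Lemma conj_KA h u : u \in KA -> K h * u * K (- h) \in KA.
Proof.
move/subalgP; elim=> [_ [j n ji]|c|x y _ IHx _ IHy|x y _ IHx _ IHy].
- by rewrite conj_string rpredZ // string_mem.
- by rewrite [X in X \in _]conj_const rpredZ // rpred1.
- by rewrite [X in X \in _]conjD rpredD.
- by rewrite [X in X \in _]conjM rpredM.
Qed.

Lemma tconj_KA u : u \in KA -> t i * u * tinv i \in KA.
Proof. exact: (conj_KA (hh i *+ d i)). Qed.

Lemma tinvconj_KA u : u \in KA -> tinv i * u * t i \in KA.
Proof. by move=> uK; have := conj_KA (- (hh i *+ d i)) uK; rewrite opprK. Qed.

Lemma ad_f_KA u : u \in KA -> adf u \in KA.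
Proof.
move/subalgP; elim=> [_ [j n ji]|c|x y Sx IHx Sy IHy|x y Sx IHx Sy IHy].
- exact: (@string_mem j n.+1).
- by rewrite [X in X \in _]ad_fZ ad_f1 scaler0 rpred0.
- by rewrite [X in X \in _]ad_fD rpredD.
- rewrite [X in X \in _]ad_fM rpredD //.
    by rewrite rpredM //; apply/subalgP.
  by rewrite rpredM // tconj_KA //; apply/subalgP.
Qed.

Lemma ad_e_KA u : u \in KA -> ade u \in KA.
Proof.
move/subalgP; elim=> [_ [j [|n] ji]|c|x y Sx IHx Sy IHy|x y Sx IHx Sy IHy].
- by rewrite ad_e_string0 // rpred0.
- by have [c -> _] := ad_e_string D ji n; rewrite rpredZ // string_mem.
- by rewrite [X in X \in _]ad_eZ ad_e1 scaler0 rpred0.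
- by rewrite [X in X \in _]ad_eD rpredD.
- rewrite [X in X \in _]ad_eM rpredD //.
    by rewrite rpredM // tinvconj_KA //; apply/subalgP.
  by rewrite rpredM //; apply/subalgP.
Qed.

Variable T : braid_symmetry D i.

Lemma refl_t : refl D i (hh i *+ d i) = - (hh i *+ d i).
Proof.
rewrite /refl pairing_t /bform; have [-> _ _ _] := cartan_GCM D.
have -> : (2 : int) *+ d i = (2 * d i)%N by rewrite -mulr_natr natz; lia.
rewrite -[hh i *~ _]/(hh i *+ (2 * d i)%N) mulnC mulrnA mulr2n.
by rewrite opprD addrA subrr add0r.
Qed.

Lemma reflN h : refl D i (- h) = - refl D i h.
Proof.
rewrite /refl -[pairing (- h) _]/(- pairing h _) mulrNz opprD.
by [].
Qed.

Lemma reflK h : refl D i (refl D i h) = h.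
Proof.
have pairingMz (k : dual P) (n : int) (x : P) : pairing (k *~ n) x = pairing k x * n.
  have pairingB : zmod_morphism (fun k : dual P => pairing k x) by [].
  pose px : {additive dual P -> int} :=
    HB.pack (fun k : dual P => pairing k x) (GRing.isZmodMorphism.Build _ _ _ pairingB).
  by rewrite -mulrzz -[RHS](raddfMz px).
have pE : pairing (refl D i h) (alpha i) = - pairing h (alpha i).
  rewrite /refl -[LHS]/(pairing h (alpha i)
    - pairing (hh i *~ pairing h (alpha i)) (alpha i)).
  rewrite pairingMz pairing_sroot; have [-> _ _ _] := cartan_GCM D.
  by rewrite mulrC; lia.
by rewrite {1}/refl pE mulrNz opprK subrK.
Qed.

Lemma braid_t : braid T (t i) = tinv i.
Proof. by rewrite braid_q refl_t. Qed.
Lemma braid_tinv : braid T (tinv i) = t i.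
Proof. by rewrite braid_q reflN refl_t opprK. Qed.

(** With its companion below, this explains the exchange of e_i and f_i in the structures
    transported by T_i. *)
Lemma braid_ad_f_star v : braid T (ad_f_star i v) = ade (braid T v).
Proof.
rewrite /ad_f_star /ad_e rmorphB !rmorphM /= braid_fi braid_t braid_tinv.
rewrite mulrN !mulNr opprK !mulrA -[_ * t i * tinv i]mulrA tK mulr1.
by rewrite addrC.
Qed.

Lemma braid_ad_e_star v : braid T (ad_e_star i v) = adf (braid T v).
Proof.
rewrite /ad_e_star /ad_f rmorphB !rmorphM /= braid_ei braid_tinv.
rewrite !mulrN mulNr opprK !mulrA tK mul1r.
by rewrite addrC.
Qed.

Let TU : U -> Prop := fun x => exists2 v, v \in Uminus & braid T v = x.

Let TU_Z (c : Qq) x : TU x -> TU (c *: x).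
Proof.
by move=> [v vm <-]; exists (c *: v); [apply: rpredZ | exact: (linearZ_LR (braid T))].
Qed.

(** Descent from the top of the string, a multiple of T_i(f_j): [ad_e] is the T_i-conjugate of
    [ad_f_star], which preserves U_q^-, and its coefficients on the string can be inverted. *)
Let TU_string j n : j != i -> TU (root_string D i j n).
Proof.
move=> ji; have [ltMn|] := ltnP `|cartan D i j|%N n.
  by rewrite string_high //; exists 0; [exact: rpred0 | exact: rmorph0].
move=> lenM; rewrite -(subKn lenM).
elim: (_ - n)%N (leq_subr n `|cartan D i j|) => {n lenM} [|k IHk] lekM.
  have [v vm vE] : TU (braid T (f j)) by exists (f j) => //; exact: f_minus.
  have -> : root_string D i j (`|cartan D i j| - 0)
      = qfact D i `|cartan D i j| *: braid T (f j).
    rewrite subn0.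
    by rewrite (braid_fj_string ji) scalerA mulfV ?qfact_neq0 // scale1r.
  by apply: TU_Z; exists v.
have [v vm vE] := IHk (ltnW lekM).
have [c cE c_neq0] := ad_e_string D ji (`|cartan D i j| - k.+1).
have -> : root_string D i j (`|cartan D i j| - k.+1) = c^-1 *: ade (braid T v).
  rewrite vE -[(_ - k)%N](prednK (n := (`|cartan D i j| - k))) ?subn_gt0 // -subnS.
  by rewrite cE scalerA mulVf ?scale1r // c_neq0 //; lia.
rewrite -braid_ad_f_star; apply: TU_Z; exists (ad_f_star i v) => //.
exact: ad_f_star_minus.
Qed.

Lemma KA_TU x : x \in KA -> TU x.
Proof.
move/subalgP; elim=> [_ [j n ji]|c|x1 x2 _ [v1 m1 e1] _ [v2 m2 e2]
  |x1 x2 _ [v1 m1 e1] _ [v2 m2 e2]].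
- exact: TU_string.
- by apply: TU_Z; exists 1; [exact: rpred1 | exact: rmorph1].
- by exists (v1 + v2); [exact: rpredD | rewrite -e1 -e2; exact: rmorphD].
- by exists (v1 * v2); [exact: rpredM | rewrite -e1 -e2; exact: rmorphM].
Qed.

(** Straightening rule: since [KA] is stable under conjugation by t_i and under [ad_e], polynomials
    in e_i t_i with left coefficients in [KA] are closed under products. *)
Lemma et_mul y : et * y = (t i * y * tinv i) * et + ade (t i * y * tinv i).
Proof.
by rewrite /ad_e [_ * et]mulrA addrC subrK -!mulrA tVK mulr1.
Qed.

Definition et_poly x := exists2 p : {poly U}, p \is a polyOver KA & p.[et] = x.

Lemma et_polyD x y : et_poly x -> et_poly y -> et_poly (x + y).
Proof.
by move=> [p pK <-] [r rK <-]; exists (p + r); [exact: rpredD | rewrite hornerD].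
Qed.

Lemma et_poly_et x : et_poly x -> et_poly (x * et).
Proof.
move=> [p pK <-]; exists (p * 'X); last by rewrite hornerMX.
by rewrite rpredM // polyOverX.
Qed.

Lemma et_poly_KA x : x \in KA -> et_poly x.
Proof. by move=> xK; exists x%:P; [rewrite polyOverC | rewrite hornerC]. Qed.

Lemma et_poly_ind (Q : U -> Prop) : (forall y, y \in KA -> Q y) ->
  (forall x y, Q x -> y \in KA -> Q (x * et + y)) -> forall x, et_poly x -> Q x.
Proof.
move=> Q0 QS _ [p pK <-]; elim/poly_ind: p pK => [|p c IHp] pK.
  by rewrite horner0; apply/Q0/rpred0.
rewrite hornerMXaddC; apply: QS.
  apply: IHp; apply/polyOverP => n; have := polyOverP pK n.+1.
  by rewrite coefD coefMX coefC addr0.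
by have := polyOverP pK 0; rewrite coefD coefMX coefC add0r.
Qed.

Lemma et_polyMr x y : et_poly x -> y \in KA -> et_poly (x * y).
Proof.
move=> px; elim/et_poly_ind: x / px y => [x xK|x x' IHx xK] y yK.
  by apply: et_poly_KA; apply: rpredM.
rewrite mulrDl; apply: et_polyD; last by apply: et_poly_KA; apply: rpredM.
rewrite -mulrA et_mul mulrDr mulrA; apply: et_polyD.
  by apply/et_poly_et/IHx/tconj_KA.
by apply/IHx/ad_e_KA/tconj_KA.
Qed.

Lemma et_polyM x y : et_poly x -> et_poly y -> et_poly (x * y).
Proof.
move=> px py; elim/et_poly_ind: y / py => [y yK|y y' IHy yK].
  exact: et_polyMr.
rewrite mulrDr mulrA; apply: et_polyD; last exact: et_polyMr.
exact: et_poly_et.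
Qed.

Lemma TU_et_poly v : v \in Uminus -> et_poly (braid T v).
Proof.
move/subalgP; elim=> [_ [j]|c|x y _ IHx _ IHy|x y _ IHx _ IHy].
- have [->|ji] := eqVneq j i.
    rewrite braid_fi -mulN1r; apply: et_polyM.
      by apply: et_poly_KA; rewrite rpredN rpred1.
    rewrite -[e i * t i]mul1r; apply/et_poly_et/et_poly_KA; exact: rpred1.
  by rewrite (braid_fj_string ji); apply: et_poly_KA; rewrite rpredZ // string_mem.
- have -> : braid T c%:A = c%:A by rewrite (linearZ_LR (braid T)) rmorph1.
  by apply: et_poly_KA; rewrite rpredZ // rpred1.
- by rewrite rmorphD; apply: et_polyD.
- by rewrite rmorphM; apply: et_polyM.
Qed.

Lemma mem_Ui x :
  (x \in cap_image (minus_gen (D := D)) (braid T)) = (x \in KA).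
Proof.
apply/cap_imageP/idP => [[xm [v vm vx]]|xK]; last first.
  by split; [exact: string_minus | exact: KA_TU].
have [p pK px] := TU_et_poly vm; rewrite vx in px.
rewrite -px in xm *; rewrite (horner_minus _ xm); first exact: (polyOverP pK).
by apply/polyOverP => n; apply/string_minus/(polyOverP pK).
Qed.

(** This is T_i(_iU) = U_i; stability of _iU can thus be tested in [KA]. *)
Lemma mem_iU v :
  (v \in cap_image (minus_gen (D := D)) (braid_inv T)) = (braid T v \in KA).
Proof.
rewrite -mem_Ui; apply/cap_imageP/cap_imageP => [[vm [y ym yv]]|[Tvm [y ym yv]]].
  by split; [rewrite -yv braid_invK | exists v].
split; first by rewrite -[v](braidK T) -yv braidK.
by exists (braid T v); rewrite ?braidK.
Qed.

End KernelAlgebra.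

(** * The four module structures *)

Section Actions.
Variables (I : eqType) (P : zmodType) (D : cartan_datum I P) (i : I).
Variable T : braid_symmetry D i.

Local Notation e := (Ue D).
Local Notation f := (Uf D).
Local Notation K := (Uqh D).
Local Notation t := (Ut D).
Local Notation tinv := (Utinv D).
Local Notation U := (Uq D).
Local Notation Uparabolic := (subalg (parabolic_gen (D := D) i)).
Local Notation KA := (subalg (string_gen (D := D) i)).
Implicit Types (u v x y : U).

Definition ract x v : U := star (lact i (star x) (star v)).

Lemma ract_linearr x : linear (ract x).
Proof. by move=> k u v; rewrite /ract linearP lact_linearr linearP. Qed.

Lemma ract_linearl v : linear (ract^~ v).
Proof. by move=> k x y; rewrite /ract linearP lact_linearl linearP. Qed.

Lemma ract1 v : ract 1 v = v.
Proof. by rewrite /ract star1 lact1 starK. Qed.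

Lemma ractM x y v : x \in Uparabolic -> y \in Uparabolic ->
  ract (x * y) v = ract y (ract x v).
Proof.
by move=> xp yp; rewrite /ract starM lactM ?star_parabolic // starK.
Qed.

Lemma star_t : star (t i) = tinv i. Proof. exact: star_q. Qed.
Lemma star_tinv : star (tinv i) = t i. Proof. by rewrite star_q opprK. Qed.

Lemma ract_e v : ract (e i) v = ad_e_star i v.
Proof.
rewrite /ract star_e lact_e /ad_e starB !starM starK star_e star_t.
by rewrite /ad_e_star !mulrA.
Qed.

Lemma ract_fi v : ract (f i) v = ad_f_star i v.
Proof.
rewrite /ract star_f lact_fi /ad_f starB !starM starK star_f star_t star_tinv.
by rewrite /ad_f_star !mulrA.
Qed.

Lemma ract_f j v : j != i -> ract (f j) v = v * f j.
Proof. by move=> ji; rewrite /ract star_f lact_f // starM starK star_f. Qed.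

Lemma ract_q h v : ract (K h) v = K (- h) * v * K h.
Proof.
by rewrite /ract star_q lact_q !starM starK !star_q !opprK mulrA.
Qed.

Lemma lact_KA x u : x \in Uparabolic -> u \in KA -> lact i x u \in KA.
Proof.
move/subalgP=> px; elim: px u => [_ [|j|h]|c|y z _ IHy _ IHz|y z py IHy pz IHz] u uK.
- by rewrite lact_e ad_e_KA.
- have [->|ji] := eqVneq j i; first by rewrite lact_fi ad_f_KA.
  have fK : f j \in KA by exact: (@string_mem _ _ D i j 0 ji).
  by rewrite lact_f // rpredM.
- by rewrite lact_q conj_KA.
- have -> : lact i c%:A u = c *: u by rewrite lactZl lact1.
  by rewrite rpredZ.
- have -> : lact i (y + z) u = lact i y u + lact i z u.
    by have := lact_linearl i u 1 y z; rewrite !scale1r.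
  by rewrite rpredD ?IHy ?IHz.
- have -> : lact i (y * z) u = lact i y (lact i z u) by apply: lactM; apply/subalgP.
  by apply/IHy/IHz.
Qed.

Lemma ract_KA x v : x \in Uparabolic -> braid T v \in KA -> braid T (ract x v) \in KA.
Proof.
move/subalgP=> px; elim: px v => [_ [|j|h]|c|y z _ IHy _ IHz|y z py IHy pz IHz] v vK.
- by rewrite ract_e braid_ad_e_star ad_f_KA.
- have [->|ji] := eqVneq j i; first by rewrite ract_fi braid_ad_f_star ad_e_KA.
  by rewrite ract_f // rmorphM rpredM //= (braid_fj_string ji) rpredZ // string_mem.
- by rewrite ract_q !rmorphM /= !braid_q reflN -[X in _ * _ * K X]opprK conj_KA.
- have -> : ract c%:A v = c *: v by rewrite /ract starZ star1 lactZl lact1 starZ starK.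
  by rewrite linearZ_LR rpredZ.
- have -> : ract (y + z) v = ract y v + ract z v.
    by have := ract_linearl v 1 y z; rewrite !scale1r.
  by rewrite rmorphD rpredD ?IHy ?IHz.
- have -> : ract (y * z) v = ract z (ract y v) by apply: ractM; apply/subalgP.
  by apply/IHz/IHy.
Qed.

Lemma braid_inv_q h : braid_inv T (K h) = K (refl D i h).
Proof. by rewrite -{1}[h](reflK D i) -(braid_q T) braidK. Qed.

End Actions.

Theorem proposition2p3p11 (I : eqType) (P : zmodType) (D : cartan_datum I P)
    (i : I) (T : braid_symmetry D i) :
  exists (rU : Ui T -> Up D i -> Ui T) (lU' : Up D i -> iU T -> iU T)
         (lU : Up D i -> Ui T -> Ui T) (rU' : iU T -> Up D i -> iU T),
    [/\ (* (1) *) is_right_module rU /\ Ui_right_action rU,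
        (* (2) *) is_left_module lU' /\ iU_left_action lU',
        (* (3) *) is_left_module lU /\ Ui_left_action lU,
                  is_right_module rU' /\ iU_right_action rU'
      & left_linear lU' lU (braid_res (T := T))
        /\ right_linear rU' rU (braid_res (T := T))].
Proof.
have UiK (u : Ui T) : val u \in subalg (string_gen (D := D) i).
  by rewrite -(mem_Ui T); apply: (valP u).
have iUK (v : iU T) : braid T (val v) \in subalg (string_gen (D := D) i).
  by rewrite -(mem_iU T); apply: (valP v).
pose in_Ui x := x \in cap_image (minus_gen (D := D)) (braid T).
pose in_iU x := x \in cap_image (minus_gen (D := D)) (braid_inv T).
have lU_mem (a : Up D i) (u : Ui T) : in_Ui (lact i (val a) (val u)).
  by rewrite /in_Ui mem_Ui lact_KA //; apply: (valP a).
have rU'_mem (a : Up D i) (v : iU T) : in_iU (ract i (val a) (val v)).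
  by rewrite /in_iU mem_iU ract_KA //; apply: (valP a).
have lU'_mem (a : Up D i) (v : iU T) :
    in_iU (braid_inv T (lact i (val a) (braid T (val v)))).
  by rewrite /in_iU mem_iU braid_invK lact_KA //; apply: (valP a).
have rU_mem (a : Up D i) (u : Ui T) :
    in_Ui (braid T (ract i (val a) (braid_inv T (val u)))).
  by rewrite /in_Ui mem_Ui ract_KA ?braid_invK //; apply: (valP a).
(* Two actions are restrictions and two are their conjugates by T_i, so that in (3) compatibility
   with the actions is mere cancellation of T_i against its inverse. *)
pose lU (a : Up D i) (u : Ui T) : Ui T := exist in_Ui _ (lU_mem a u).
pose rU' (v : iU T) (a : Up D i) : iU T := exist in_iU _ (rU'_mem a v).
pose lU' (a : Up D i) (v : iU T) : iU T := exist in_iU _ (lU'_mem a v).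
pose rU (u : Ui T) (a : Up D i) : Ui T := exist in_Ui _ (rU_mem a u).
exists rU, lU', lU, rU'; split.
- split; split.
  + move=> a k u v; apply: val_inj.
    rewrite -[LHS]/(braid T (ract i (val a) (braid_inv T (k *: val u + val v)))).
    by rewrite linearP ract_linearr linearP.
  + move=> u k a b; apply: val_inj.
    rewrite -[LHS]/(braid T (ract i (k *: val a + val b) (braid_inv T (val u)))).
    by rewrite ract_linearl linearP.
  + move=> u; apply: val_inj.
    by rewrite -[LHS]/(braid T (ract i 1 (braid_inv T (val u)))) ract1 braid_invK.
  + move=> u a b; apply: val_inj.
    rewrite -[LHS]/(braid T (ract i (val a * val b) (braid_inv T (val u)))).
    by rewrite ractM ?(valP a) ?(valP b) //= braidK.
  + move=> u; rewrite -[LHS]/(braid T (ract i (Uf D i) (braid_inv T (val u)))).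
    by rewrite ract_fi braid_ad_f_star braid_invK.
  + move=> u; rewrite -[LHS]/(braid T (ract i (Ue D i) (braid_inv T (val u)))).
    by rewrite ract_e braid_ad_e_star braid_invK.
  + move=> u j ji; rewrite -[LHS]/(braid T (ract i (Uf D j) (braid_inv T (val u)))).
    by rewrite ract_f // rmorphM /= braid_invK.
  + move=> u h; rewrite -[LHS]/(braid T (ract i (Uqh D h) (braid_inv T (val u)))).
    by rewrite ract_q !rmorphM /= !braid_q reflN braid_invK.
- split; split.
  + move=> a k u v; apply: val_inj.
    rewrite -[LHS]/(braid_inv T (lact i (val a) (braid T (k *: val u + val v)))).
    by rewrite linearP lact_linearr linearP.
  + move=> u k a b; apply: val_inj.
    rewrite -[LHS]/(braid_inv T (lact i (k *: val a + val b) (braid T (val u)))).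
    by rewrite lact_linearl linearP.
  + move=> u; apply: val_inj.
    by rewrite -[LHS]/(braid_inv T (lact i 1 (braid T (val u)))) lact1 braidK.
  + move=> a b u; apply: val_inj.
    rewrite -[LHS]/(braid_inv T (lact i (val a * val b) (braid T (val u)))).
    by rewrite lactM ?(valP a) ?(valP b) //= braid_invK.
  + move=> u; rewrite -[LHS]/(braid_inv T (lact i (Uf D i) (braid T (val u)))).
    by rewrite lact_fi -braid_ad_e_star braidK.
  + move=> u; rewrite -[LHS]/(braid_inv T (lact i (Ue D i) (braid T (val u)))).
    by rewrite lact_e -braid_ad_f_star braidK.
  + move=> u j ji; rewrite -[LHS]/(braid_inv T (lact i (Uf D j) (braid T (val u)))).
    by rewrite lact_f // rmorphM /= braidK.
  + move=> u h; rewrite -[LHS]/(braid_inv T (lact i (Uqh D h) (braid T (val u)))).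
    by rewrite lact_q !rmorphM /= !braid_inv_q reflN braidK.
- split; split.
  + by move=> a k u v; apply: val_inj; apply: lact_linearr.
  + by move=> u k a b; apply: val_inj; apply: lact_linearl.
  + by move=> u; apply: val_inj; apply: lact1.
  + by move=> a b u; apply: val_inj; apply: lactM; apply: valP.
  + by move=> u; apply: lact_fi.
  + by move=> u; apply: lact_e.
  + by move=> u j ji; apply: lact_f.
  + by move=> u h; apply: lact_q.
- split; split.
  + by move=> a k u v; apply: val_inj; apply: ract_linearr.
  + by move=> u k a b; apply: val_inj; apply: ract_linearl.
  + by move=> u; apply: val_inj; apply: ract1.
  + by move=> u a b; apply: val_inj; apply: ractM; apply: valP.
  + by move=> u; apply: ract_fi.
  + by move=> u; apply: ract_e.
  + by move=> u j ji; apply: ract_f.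
  + by move=> u h; apply: ract_q.
have res_linear : linear (braid_res (T := T)).
  by move=> k u v; apply: val_inj; apply: (linearP (braid T)).
split; split=> //.
  by move=> a u; apply: val_inj; apply: braid_invK.
move=> u a; apply: val_inj.
rewrite -[LHS]/(braid T (ract i (val a) (val u))).
by rewrite -[RHS]/(braid T (ract i (val a) (braid_inv T (braid T (val u))))) braidK.
Qed.
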